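(* Let $\alpha=1$ and let $\phi_1(t)=t^{-1/2}(\log t)^{-1/2}$. Then $\mathbf{P}$-almost surely, \[\limsup_{t\to\infty}\frac{p_t^\omega(0,0)}{\phi_1(t)}\in(0,\infty),\] and \[\liminf_{t\to\infty}\frac{p_t^\omega(0,0)\,(\log\log t)^{\theta}}{\phi_1(t)}=0 \text{ if } \theta=\tfrac12,\qquad \liminf_{t\to\infty}\frac{p_t^\omega(0,0)\,(\log\log t)^{\theta}}{\phi_1(t)}=\infty \text{ if } \theta>3.\]
   Context: One-dimensional symmetric Bouchaud trap model. Fix $\alpha>0$. Let $\tau=\{\tau_x\}_{x\in\mathbb{Z}}$ be i.i.d. random variables (the random environment, with law $\mathbf{P}$ and expectation $\mathbf{E}$; $\omega$ denotes a realisation of the environment) with $\mathbf{P}(\tau_x>u)=u^{-\alpha}$ for all $u\ge 1$. Given $\tau$, let $X=(X_t)_{t\ge0}$ be the continuous-time Markov chain on $\mathbb{Z}$ with generator $\mathcal{L}f(x)=\frac{1}{2\tau_x}\sum_{y\sim x}(f(y)-f(x))$ (sum over the two nearest neighbours of $x$); i.e. $X$ waits at $x$ an exponential time with mean $\tau_x$ and then jumps to a uniformly chosen neighbour. Write $P^\omega_x$ for the quenched law of $X$ started at $x$. The measure $\sum_x\tau_x\delta_x$ is reversible/invariant for $X$, and the quenched heat kernel is $p_t^\omega(x,y)=P^\omega_x(X_t=y)/\tau_y$. *)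

(* Defs.v *)
From HB Require Import structures.
From mathcomp Require Import all_boot all_order all_algebra.
From mathcomp Require Import all_classical all_reals all_analysis.
Set Implicit Arguments. Unset Strict Implicit. Unset Printing Implicit Defensive.
Import Order.TTheory GRing.Theory Num.Theory.
Local Open Scope classical_set_scope.
Local Open Scope ring_scope.

Section Defs.
Context {R : realType}.

Definition mutually_independent {d} {T : measurableType d}
  (P : probability T R) (X : int -> T -> R) : Prop :=
  forall (J : seq int) (B : int -> set R), uniq J ->
    (forall i, measurable (B i)) ->
    P (\bigcap_(i in [set i | i \in J]) (X i @^-1` B i))
    = (\prod_(i <- J) P (X i @^-1` B i))%E.

(* One-step kernel of the uniformised (rate 1) Bouchaud chain in environment
   tau: from x, stay with prob 1 - 1/tau_x, jump to each neighbour with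
   prob 1/(2 tau_x).  (The CTMC has jump rate 1/tau_x <= 1.) *)
Definition jumpK (tau : int -> R) (x y : int) : R :=
  if y == x then 1 - (tau x)^-1
  else if (y == x + 1) || (y == x - 1) then (2 * tau x)^-1 else 0.

Fixpoint Kpow (tau : int -> R) (n : nat) (x y : int) : R :=
  match n with
  | 0%N => (x == y)%:R
  | n'.+1 => \sum_(z <- [:: x - 1; x; x + 1]) jumpK tau x z * Kpow tau n' z y
  end.

(* Quenched transition probability P^omega_x(X_t = y) of the CTMC with
   generator Lf(x) = (1/(2 tau_x)) sum_{y~x} (f y - f x), via uniformisation
   at rate 1 (valid since tau_x >= 1): sum_n e^{-t} t^n/n! K^n(x,y). *)
Definition trans_prob (tau : int -> R) (t : R) (x y : int) : R :=
  limn (fun N : nat => \sum_(0 <= n < N) (expR (- t) * t ^+ n / (n`!)%:R * Kpow tau n x y)).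

Definition heat_kernel (tau : int -> R) (t : R) (x y : int) : R :=
  trans_prob tau t x y / tau y.

Definition limsup_pinfty (f : R -> R) : \bar R :=
  ereal_inf [set ereal_sup [set (f t)%:E | t in [set t | T <= t]] | T in [set: R]].
Definition liminf_pinfty (f : R -> R) : \bar R :=
  ereal_sup [set ereal_inf [set (f t)%:E | t in [set t | T <= t]] | T in [set: R]].

Definition phi1 (t : R) : R := t `^ (- 2^-1) * (ln t) `^ (- 2^-1).

End Defs.

(* Main.v *)
Require Import Defs.
From HB Require Import structures.
From mathcomp Require Import all_boot all_order all_algebra.
From mathcomp Require Import all_classical all_reals all_analysis.
From mathcomp Require Import measurable_realfun zify ring lra.
Import Order.TTheory GRing.Theory Num.Theory.
Import numFieldNormedType.Exports.
Local Open Scope classical_set_scope.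
Local Open Scope ring_scope.

(** Write [p_t] for the quenched heat kernel at the origin and [V r] for the
    volume of [-r, r].

    Upper bound: comparing [p_t] at 0 with its average over [-r, r] along paths,
    and bounding the Dirichlet energy of [p_t] by [p_t / t] (convexity of
    [t |-> p_t]), gives [p_t <= 2 / V r + 2 r / t].

    Lower bound: let [H] vanish at 0 and have discrete second derivative [2 tau]
    away from 0, so that [E_0 H(X_s) <= s].  By Markov's inequality half of the mass
    at time [s] sits in [{H < 2 s}], and Cauchy-Schwarz gives [p_{2s} >= 1 / (4 V r)]
    whenever [H >= 2 s] off [-r, r]; this allows [s] of order [r^2 log r].

    Almost surely, [V r >= c r log r] eventually, [V r <= C r log r] for infinitely
    many [r], [V r <= C r log r (log log r)^2] for all large dyadic [r], and for every
    [a] infinitely many sites have [tau_x > a x log x log log x].  The first three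
    come from Chebyshev's inequality for truncated sums, the last from the divergence
    of [sum 1 / (x log x log log x)].  At [r = x] such a site makes the upper
    bound small, which gives the statement for exponent 1/2; the lower bound
    is of order [phi1 t (log log t)^-2]. *)

(** * Poisson averages *)

Section PoissonSeries.
Context {R : realType}.
Implicit Types (a b : nat -> R) (t : R).

Definition fact_weight a : nat -> R := fun n => a n / n`!%:R.
(** The expectation of [a] at a Poisson variable of mean [t]. The power-series form makes termwise
    differentiation in [t] available. *)
Definition pois a t : R := expR (- t) * limn (pseries (fact_weight a) t).
Definition pois_weight t (n : nat) : R := expR (- t) * t ^+ n / n`!%:R.

Lemma pseries_fact_cvg a t : (forall n, `|a n| <= 1) ->
  cvgn (pseries (fact_weight a) t).
Proof.
move=> a1; apply: normed_cvg.
apply: (@series_le_cvg _ _ (fun n => `|t| ^+ n / n`!%:R)) => /= [n|n|n|].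
- by rewrite normr_ge0.
- by rewrite divr_ge0// exprn_ge0.
- rewrite /fact_weight !normrM normrX normfV (ger0_norm (ler0n _ _)).
  rewrite mulrAC ler_wpM2r ?invr_ge0//.
  by rewrite -[leRHS]mul1r ler_wpM2r// exprn_ge0.
- exact: is_cvg_series_exp_coeff.
Qed.

Lemma pois_cvg a t : (forall n, `|a n| <= 1) ->
  (\sum_(0 <= n < N) pois_weight t n * a n) @[N --> \oo] --> pois a t.
Proof.
move=> a1; rewrite /pois.
rewrite (_ : (fun N => _) = (fun N => expR (- t) * pseries (fact_weight a) t N)).
  by apply: cvgMr; exact: pseries_fact_cvg.
apply/funext => N; rewrite /pseries /series /= mulr_sumr.
by apply: eq_bigr => n _; rewrite /pois_weight /fact_weight; ring.
Qed.

Lemma pois_weight_ge0 t n : 0 <= t -> 0 <= pois_weight t n.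
Proof. by move=> t0; rewrite divr_ge0// mulr_ge0 ?expR_ge0// exprn_ge0. Qed.

Lemma pois1 t : pois (fun=> 1) t = 1.
Proof.
rewrite /pois (_ : pseries _ _ = series (exp_coeff t)).
  by rewrite -/(expR t) -expRD addNr expR0.
apply/funext => N; rewrite /pseries /series /=; apply: eq_bigr => n _.
by rewrite /fact_weight /exp_coeff /= mul1r mulrC.
Qed.

Lemma sum_pois_weight_cvg t :
  (\sum_(0 <= n < N) pois_weight t n) @[N --> \oo] --> (1 : R).
Proof.
have := @pois_cvg (fun=> 1) t (fun=> ltac:(by rewrite normr1)).
by rewrite pois1; under eq_fun do under eq_bigr do rewrite mulr1.
Qed.

Lemma sum_pois_weight_le1 t N : 0 <= t -> \sum_(0 <= n < N) pois_weight t n <= 1.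
Proof.
move=> t0; have h := @sum_pois_weight_cvg t; rewrite -(cvg_lim _ h)//.
apply: (@nondecreasing_cvgn_le _ (fun N => \sum_(0 <= n < N) pois_weight t n)).
  apply/nondecreasing_seqP => n; rewrite big_nat_recr//= lerDl.
  exact: pois_weight_ge0.
by apply/cvg_ex; exists 1.
Qed.

Lemma pois_ge0 a t : 0 <= t -> (forall n, 0 <= a n <= 1) -> 0 <= pois a t.
Proof.
move=> t0 a01.
have h : forall n, `|a n| <= 1 by move=> n; have /andP[u v] := a01 n; rewrite ger0_norm.
rewrite -(cvg_lim _ (@pois_cvg a t h))//; apply: limr_ge.
  by apply/cvg_ex; exists (pois a t); exact: pois_cvg.
near=> N; apply: sumr_ge0 => n _; rewrite mulr_ge0 ?pois_weight_ge0//.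
by have /andP[] := a01 n.
Unshelve. all: by end_near. Qed.

(** Differentiating the power series shifts the coefficients by one, and the factor [expR (- t)]
    contributes the subtracted term: time derivatives of Poisson averages are forward
    differences. *)
Lemma is_derive_pois a t : (forall n, `|a n| <= 1) ->
  is_derive t (1 : R) (pois a) (pois (fun n => a n.+1) t - pois a t).
Proof.
move=> a1.
have dE b : pseries_diffs (fact_weight b) = fact_weight (fun n => b n.+1).
  apply/funext => n; rewrite /pseries_diffs /fact_weight factS natrM.
  have h1 : n.+1%:R != 0 :> R by rewrite pnatr_eq0.
  have h2 : n`!%:R != 0 :> R by rewrite pnatr_eq0 -lt0n fact_gt0.
  by field; rewrite h2 addrC natr1.
have [] : is_derive t (1 : R) (fun x => limn (pseries (fact_weight a) x))
    (limn (pseries (fact_weight (fun n => a n.+1)) t)).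
  (* Termwise differentiation at [t] asks for convergence of the series and of its first two derived
     series at a point of larger modulus, here [|t| + 1]. *)
  rewrite -dE; apply: (@pseries_snd_diffs _ _ (`|t| + 1)).
  - exact: pseries_fact_cvg.
  - by rewrite dE; apply: pseries_fact_cvg.
  - by rewrite !dE; apply: pseries_fact_cvg.
  - by rewrite [ltRHS]ger0_norm ?ltrDl// addr_ge0.
move=> d1 d2.
have hE : is_derive t (1 : R) (fun x => expR (- x)) (- expR (- t)).
  have := @is_derive1_comp _ (@expR R) (@GRing.opp R) t (expR (- t)) (- 1).
  by rewrite mulrN1 => h; apply: h; apply/is_deriveN.
have := is_deriveM hE (DeriveDef d1 d2).
move=> h; apply: (is_derive_eq h).
by rewrite /pois /GRing.scale /=; ring.
Qed.

Lemma triangle_sum (F : nat -> nat -> R) N :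
  \sum_(0 <= n < N) \sum_(0 <= m < N | (n + m < N)%N) F n m =
  \sum_(0 <= k < N) \sum_(0 <= n < k.+1) F n (k - n)%N.
Proof.
transitivity (\sum_(0 <= n < N) \sum_(0 <= k < N | (n <= k)%N) F n (k - n)%N).
  apply: eq_big_nat => n /andP[_ nN].
  transitivity (\sum_(0 <= m < N - n) F n m).
    rewrite (@big_nat_widen _ _ _ 0 (N - n) N) ?leq_subr//.
    by apply: eq_bigl => m /=; lia.
  transitivity (\sum_(n <= k < N) F n (k - n)%N).
    rewrite -[X in _ = \sum_(X <= _ < _) _]add0n big_addn; apply: eq_bigr => m _.
    by rewrite addnK.
  by rewrite (@big_nat_widenl _ _ _ n 0).
rewrite !big_mkord.
under eq_bigr do rewrite big_mkord.
rewrite (exchange_big_dep xpredT)//=; apply: eq_bigr => k _.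
rewrite (@big_nat_widen _ _ _ 0 k.+1 N)//= big_mkord.
by apply: eq_bigl => i; rewrite ltnS.
Qed.

(** The sum of two independent Poisson variables of mean [t] is Poisson of mean [2 t]. Partial sums
    are taken over squares because these come from pairing a truncated kernel with itself. Sums over
    the triangle [n + m < N] are exactly the partial sums at [2 t], and the rest of the square
    carries vanishing mass. *)
Lemma pois_double_cvg a t : 0 <= t -> (forall n, `|a n| <= 1) ->
  (\sum_(0 <= n < N) \sum_(0 <= m < N)
     pois_weight t n * pois_weight t m * a (n + m)%N) @[N --> \oo]
  --> pois a (2 * t).
Proof.
move=> t0 a1.
pose sq b N := \sum_(0 <= n < N) \sum_(0 <= m < N)
     pois_weight t n * pois_weight t m * b (n + m)%N.
pose tri b N := \sum_(0 <= n < N) \sum_(0 <= m < N | (n + m < N)%N)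
     pois_weight t n * pois_weight t m * b (n + m)%N.
have triE b N : tri b N = \sum_(0 <= k < N) pois_weight (2 * t) k * b k.
  rewrite /tri triangle_sum; apply: eq_bigr => k _.
  transitivity (\sum_(0 <= n < k.+1) expR (- (2 * t)) / k`!%:R * b k * (t ^+ k *+ 'C(k, n))).
    apply: eq_big_nat => n /andP[_ nk]; rewrite subnKC//.
    rewrite -[t ^+ k *+ _]mulr_natr.
    have -> : t ^+ k = t ^+ n * t ^+ (k - n) by rewrite -exprD subnKC.
    have : ('C(k, n) * (n`! * (k - n)`!))%:R = k`!%:R :> R by rewrite bin_fact.
    rewrite !natrM => <-; rewrite /pois_weight.
    have -> : expR (- (2 * t)) = expR (- t) * expR (- t).
      by rewrite -expRD; congr expR; ring.
    have h1 : n`!%:R != 0 :> R by rewrite pnatr_eq0 -lt0n fact_gt0.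
    have h2 : (k - n)`!%:R != 0 :> R by rewrite pnatr_eq0 -lt0n fact_gt0.
    have h3 : 'C(k, n)%:R != 0 :> R by rewrite pnatr_eq0 -lt0n bin_gt0.
    by field; rewrite h1 h2 h3.
  rewrite -mulr_sumr /pois_weight.
  have -> : \sum_(0 <= n < k.+1) t ^+ k *+ 'C(k, n) = (2 * t) ^+ k.
    rewrite (_ : 2 * t = t + t); last by ring.
    rewrite exprDn big_mkord; apply: eq_bigr => i _.
    by rewrite -exprD subnK// -ltnS.
  by ring.
have sq1 : sq (fun=> 1) @ \oo --> (1 : R).
  rewrite (_ : sq _ = (fun N => (\sum_(0 <= n < N) pois_weight t n) *
                                (\sum_(0 <= n < N) pois_weight t n))).
    by rewrite -[X in _ --> X]mulr1; apply: cvgM; exact: sum_pois_weight_cvg.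
  apply/funext => N; rewrite /sq mulr_suml; apply: eq_bigr => n _.
  by rewrite mulr_sumr; apply: eq_bigr => m _; rewrite mulr1.
have tri1 : tri (fun=> 1) @ \oo --> (1 : R).
  rewrite (_ : tri _ = (fun N => \sum_(0 <= n < N) pois_weight (2 * t) n)).
    exact: sum_pois_weight_cvg.
  by apply/funext => N; rewrite triE; apply: eq_bigr => n _; rewrite mulr1.
have d0 : (sq (fun=> 1) \- tri (fun=> 1)) @ \oo --> (0 : R).
  by rewrite -[X in _ --> X](subrr 1); apply: cvgB.
have tria : tri a @ \oo --> pois a (2 * t).
  have -> : tri a = (fun N => \sum_(0 <= k < N) pois_weight (2 * t) k * a k).
    by apply/funext => N; exact: triE.
  exact: pois_cvg.
(* As [a] is bounded by 1, the part of the square outside the triangle is dominated by its Poisson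
   mass, which tends to [1 - 1]. *)
have hle N : `|sq a N - tri a N| <= sq (fun=> 1) N - tri (fun=> 1) N.
  have E b : sq b N - tri b N = \sum_(0 <= n < N) \sum_(0 <= m < N | ~~ (n + m < N)%N)
       pois_weight t n * pois_weight t m * b (n + m)%N.
    rewrite /sq /tri -sumrB; apply: eq_bigr => n _.
    rewrite (bigID (fun m => (n + m < N)%N))/=.
    by rewrite [X in X - _]addrC addrK.
  rewrite !E (le_trans (ler_norm_sum _ _ _))//; apply: ler_sum => n _.
  rewrite (le_trans (ler_norm_sum _ _ _))//; apply: ler_sum => m _.
  have w0 : 0 <= pois_weight t n * pois_weight t m.
    by rewrite mulr_ge0 ?pois_weight_ge0.
  by rewrite normrM (ger0_norm w0) ler_wpM2l.
have da : (sq a \- tri a) @ \oo --> (0 : R).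
  apply/norm_cvg0P.
  apply: (@squeeze_cvgr _ _ _ _ (fun=> 0) (sq (fun=> 1) \- tri (fun=> 1))) => //.
    by apply: nearW => k; rewrite /= normr_ge0/=; exact: hle.
  exact: cvg_cst.
rewrite -[X in _ --> X]add0r.
rewrite (_ : (fun N => _) = (sq a \- tri a) \+ tri a); first exact: cvgD.
by apply/funext => N /=; rewrite subrK.
Qed.

End PoissonSeries.

(** * The uniformised chain *)

Section Window.
Context {R : realType}.
Implicit Types (F G u : int -> R) (M r : nat).

(** The sum over the window [[-M, M]], grouped in symmetric pairs so that induction on [M] adds the
    two new end points. *)
Definition wsum M F : R :=
  F 0 + \sum_(0 <= i < M) (F i.+1%:Z + F (- i.+1%:Z)).

Lemma wsumS M F : wsum M.+1 F = wsum M F + (F M.+1%:Z + F (- M.+1%:Z)).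
Proof. by rewrite /wsum big_nat_recr//= addrA. Qed.

Lemma wsum0 F : wsum 0 F = F 0.
Proof. by rewrite /wsum big_geq// addr0. Qed.

Lemma wsumD M F G : wsum M (fun x => F x + G x) = wsum M F + wsum M G.
Proof. by elim: M => [|M IH]; rewrite ?wsum0// !wsumS IH; ring. Qed.

Lemma wsumZ M c F : wsum M (fun x => c * F x) = c * wsum M F.
Proof. by elim: M => [|M IH]; rewrite ?wsum0// !wsumS IH; ring. Qed.

Lemma wsum_sum M (s : seq nat) (F : nat -> int -> R) :
  wsum M (fun x => \sum_(n <- s) F n x) = \sum_(n <- s) wsum M (F n).
Proof.
elim: s => [|n s IH].
  rewrite big_nil; elim: M => [|M IH]; rewrite ?wsum0 ?wsumS ?big_nil//.
  by rewrite IH !addr0.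
rewrite big_cons -IH -wsumD; congr wsum; apply/funext => x.
by rewrite big_cons.
Qed.

Lemma wsum_shift M u : wsum M (fun x => u (x + 1) - u x) = u M.+1%:Z - u (- M%:Z).
Proof.
elim: M => [|M IH]; first by rewrite wsum0 oppr0 add0r.
rewrite wsumS IH.
have -> : - M.+1%:Z + 1 = - M%:Z by lia.
have -> : M.+1%:Z + 1 = M.+2%:Z by lia.
by ring.
Qed.

Lemma ler_wsum M F G : (forall x, (`|x| <= M)%N -> F x <= G x) -> wsum M F <= wsum M G.
Proof.
move=> FG; rewrite /wsum lerD ?FG//; apply: ler_sum_nat => i /andP[_ iM].
by rewrite lerD// FG//; lia.
Qed.

Lemma eq_wsum M F G : (forall x, (`|x| <= M)%N -> F x = G x) -> wsum M F = wsum M G.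
Proof. by move=> FG; apply/eqP; rewrite eq_le !ler_wsum// => x /FG ->. Qed.

Lemma wsum_ge0 M F : (forall x, 0 <= F x) -> 0 <= wsum M F.
Proof. by move=> F0; rewrite addr_ge0// sumr_ge0// => i _; rewrite addr_ge0. Qed.

Lemma wsum_mono r M F : (forall x, 0 <= F x) -> (r <= M)%N -> wsum r F <= wsum M F.
Proof.
move=> F0; elim: M => [|M IH]; first by rewrite leqn0 => /eqP ->.
rewrite leq_eqVlt => /predU1P[->//|rM].
by rewrite wsumS (le_trans (IH _))// lerDl addr_ge0.
Qed.

Lemma wsum_restrict r M F : (r <= M)%N ->
  wsum M (fun x => F x * (`|x| <= r)%N%:R) = wsum r F.
Proof.
elim: M => [|M IH] rM.
  move: rM; rewrite leqn0 => /eqP ->.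
  by rewrite !wsum0 mulr1.
move: rM; rewrite leq_eqVlt => /predU1P[->|rM].
  by apply: eq_wsum => x ->; rewrite mulr1.
rewrite wsumS IH//.
have -> : (`|M.+1%:Z| <= r)%N = false by lia.
by rewrite !mulr0 !addr0.
Qed.

Lemma wsum_delta M F : wsum M (fun x => F x * (x == 0)%:R) = F 0.
Proof.
by rewrite -[RHS](wsum0 F) -(@wsum_restrict 0 M).
Qed.

Lemma wsum_half M F : (forall x, 0 <= F x) ->
  \sum_(0 <= i < M) F i%:Z <= wsum M F /\ \sum_(0 <= i < M) F (- i.+1%:Z) <= wsum M F.
Proof.
move=> F0; split.
  apply: (@le_trans _ _ (\sum_(0 <= i < M.+1) F i%:Z)).
    by rewrite big_nat_recr//= lerDl.
  by rewrite big_nat_recl//= lerD//; apply: ler_sum => i _; rewrite lerDl.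
by rewrite /wsum ler_wpDl//; apply: ler_sum => i _; rewrite lerDr.
Qed.

(* [d <= e / 2 + d^2 / (2 e)] along the path from [0] to [y]. *)
Lemma wsum_path M r (f : int -> R) (e : R) y : 0 < e -> (`|y| <= r)%N -> (r <= M)%N ->
  f 0 <= f y + r%:R * (e / 2) + wsum M (fun x => (f (x + 1) - f x) ^+ 2) / (2 * e).
Proof.
move=> e0 yr rM.
pose D := fun x => (f (x + 1) - f x) ^+ 2.
have D0 x : 0 <= D x by rewrite sqr_ge0.
have amgm (d : R) : d <= e / 2 + d ^+ 2 / (2 * e).
  rewrite -subr_ge0 (_ : _ - _ = (e - d) ^+ 2 / (2 * e)).
    by rewrite divr_ge0 ?sqr_ge0// mulr_ge0// ltW.
  by field; rewrite gt_eqF.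
have [W1 W2] := wsum_half `|y|%N _ D0.
have WM : wsum `|y|%N D <= wsum M D by apply: wsum_mono => //; exact: leq_trans rM.
rewrite -lerBlDl opprD.
have key : f 0 - f y <= `|y|%N%:R * (e / 2) + wsum M D / (2 * e).
  have e2 : 0 <= (2 * e)^-1 by rewrite invr_ge0 mulr_ge0// ltW.
  case: y yr W1 W2 WM => n yr W1 W2 WM.
    have -> : f 0 - f n = \sum_(0 <= i < n) (f i%:Z - f (i.+1%:Z)).
      by rewrite -[RHS]opprK -sumrN; under eq_bigr do rewrite opprB; rewrite telescope_sumr// opprB.
    apply: (@le_trans _ _ (\sum_(0 <= i < n) (e / 2 + D i%:Z / (2 * e)))).
      apply: ler_sum => i _; rewrite (le_trans (amgm _))// lerD2l.
      by rewrite /D (_ : i%:Z + 1 = i.+1%:Z) -1?sqrrN ?opprB//; lia.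
    rewrite big_split/= sumr_const_nat subn0 -[_ *+ n]mulr_natl -mulr_suml.
    by apply: lerD => //; rewrite ler_wpM2r// (le_trans W1).
  rewrite NegzE.
  have -> : f 0 - f (- n.+1%:Z) = \sum_(0 <= i < n.+1) (f (- i%:Z) - f (- i.+1%:Z)).
    by rewrite -[RHS]opprK -sumrN; under eq_bigr do rewrite opprB; rewrite (telescope_sumr (fun i : nat => f (- i%:Z)))// opprB oppr0.
  apply: (@le_trans _ _ (\sum_(0 <= i < n.+1) (e / 2 + D (- i.+1%:Z) / (2 * e)))).
    apply: ler_sum => i _; rewrite (le_trans (amgm _))// lerD2l.
    by rewrite /D (_ : - i.+1%:Z + 1 = - i%:Z)//; lia.
  rewrite big_split/= sumr_const_nat subn0 -[_ *+ n.+1]mulr_natl -mulr_suml.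
  by apply: lerD => //; rewrite ler_wpM2r// (le_trans W2).
have : `|y|%N%:R * (e / 2) <= r%:R * (e / 2).
  by rewrite ler_wpM2r ?ler_nat// divr_ge0// ltW.
by rewrite -/D; move: key; lra.
Qed.

End Window.

(** * Reversibility, Dirichlet form and truncated heat kernels *)

Section Chain.
Context {R : realType}.
Variable tau : int -> R.
Hypothesis tau1 : forall x, 1 <= tau x.
Implicit Types (f g : int -> R) (M N n m r : nat) (s t : R).

Let tau0 x : 0 < tau x. Proof. exact: lt_le_trans (tau1 x). Qed.
Let tauN x : tau x != 0. Proof. by rewrite gt_eqF. Qed.

(** The transition operator of the uniformised chain: the expectation of [f] after one step from
    [x]. *)
Definition Kop f (x : int) : R :=
  (1 - (tau x)^-1) * f x + (2 * tau x)^-1 * (f (x - 1) + f (x + 1)).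
Definition delta0 (x : int) : R := (x == 0)%:R.
(** The probability of sitting at 0 after [n] steps from [x]. By reversibility, [tau x * kern n x]
    is [tau 0] times the probability of going from 0 to [x] in [n] steps. *)
Definition kern n : int -> R := iter n Kop delta0.

Lemma Kpow_iter n x y : Kpow tau n x y = iter n Kop (fun x => (x == y)%:R) x.
Proof.
elim: n x => [//|n IH] x.
rewrite /= !big_cons big_nil addr0 !IH /Kop /jumpK.
have -> : (x - 1 == x) = false by lia.
have -> : (x - 1 == x + 1) = false by lia.
have -> : (x + 1 == x) = false by lia.
by rewrite !eqxx/=; ring.
Qed.

Lemma Kpow00 n : Kpow tau n 0 0 = kern n 0.
Proof. exact: Kpow_iter. Qed.

Lemma ler_Kop f g : (forall x, f x <= g x) -> forall x, Kop f x <= Kop g x.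
Proof.
move=> fg x; rewrite lerD// ler_wpM2l ?lerD//.
  by rewrite subr_ge0 invf_le1.
by rewrite invr_ge0 mulr_ge0// ltW.
Qed.

Lemma Kop_cst c : Kop (fun=> c) = (fun=> c).
Proof. by apply/funext => x; rewrite /Kop; field. Qed.

Lemma iter_Kop_cst c n : iter n Kop (fun=> c) = (fun=> c).
Proof. by elim: n => //= n ->; rewrite Kop_cst. Qed.

Lemma ler_iterKop n f g : (forall x, f x <= g x) ->
  forall x, iter n Kop f x <= iter n Kop g x.
Proof. by move=> fg; elim: n => //= n IH x; apply: ler_Kop. Qed.

Lemma iter_Kop_itv01 n f : (forall x, 0 <= f x <= 1) -> forall x, 0 <= iter n Kop f x <= 1.
Proof.
move=> f01 x.
have h0 z : 0 <= f z by have /andP[] := f01 z.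
have h1 z : f z <= 1 by have /andP[] := f01 z.
have := ler_iterKop n _ _ h0 x; have := ler_iterKop n _ _ h1 x.
by rewrite !iter_Kop_cst => -> ->.
Qed.

Lemma kern01 n x : 0 <= kern n x <= 1.
Proof. by apply: iter_Kop_itv01 => z; rewrite /delta0; case: eqP => _; rewrite lexx ler01. Qed.

Lemma kern_supp n x : (n < `|x|)%N -> kern n x = 0.
Proof.
elim: n x => [|n IH] x nx.
  by rewrite /kern/= /delta0; case: eqP nx => // ->.
have e0 := IH x; have e1 := IH (x - 1); have e2 := IH (x + 1).
by rewrite /kern iterS /Kop -/(kern n) e0 ?e1 ?e2; [rewrite !(addr0, mulr0)|lia..].
Qed.

(** Reversibility with respect to [tau]. The difference of the two sides telescopes through the
    discrete Wronskian [u], and the boundary terms only see [f] at distance [M] or [M + 1] from 0,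
    where it vanishes. *)
Lemma Kop_sym M f g : (forall x, (M <= `|x|)%N -> f x = 0) ->
  wsum M (fun x => tau x * Kop f x * g x) = wsum M (fun x => tau x * f x * Kop g x).
Proof.
move=> fM; apply/eqP; rewrite -subr_eq0.
pose u x := 2^-1 * (f x * g (x - 1) - f (x - 1) * g x).
have -> : wsum M (fun x => tau x * Kop f x * g x) - wsum M (fun x => tau x * f x * Kop g x)
   = wsum M (fun x => u (x + 1) - u x).
  rewrite -mulN1r -wsumZ -wsumD; apply: eq_wsum => x _.
  by rewrite /u /Kop addrK; field.
rewrite wsum_shift /u !(fM M.+1%:Z) ?(fM (- M%:Z)); [|lia..].
rewrite (fM (M.+1%:Z - 1)) ?(fM (- M%:Z - 1)); [|lia..].
by rewrite !mul0r subrr.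
Qed.

(** Summation by parts: the difference of the two sides telescopes through [v], with vanishing
    boundary terms. *)
Lemma dirichlet M f : (forall x, (M <= `|x|)%N -> f x = 0) ->
  wsum M (fun x => (f (x + 1) - f x) ^+ 2) =
  2 * wsum M (fun x => tau x * f x * (f x - Kop f x)).
Proof.
move=> fM; apply/eqP; rewrite -subr_eq0 -wsumZ -mulN1r -wsumZ -wsumD.
pose v x := f x * (f x - f (x - 1)).
rewrite (@eq_wsum _ _ _ (fun x => v (x + 1) - v x)); last first.
  by move=> x _; rewrite /v /Kop addrK; field.
by rewrite wsum_shift /v !(fM M.+1%:Z) ?(fM (- M%:Z)); [rewrite !mul0r subrr|lia..].
Qed.

(** Symmetry moves the [n] copies of [Kop] from the kernel to [g], leaving the expectation of [g]
    after [n] steps from 0. The condition [n < M] keeps every boundary term zero. *)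
Lemma kern_pairing M n g : (n < M)%N ->
  wsum M (fun x => tau x * kern n x * g x) = tau 0 * iter n Kop g 0.
Proof.
elim: n g => [|n IH] g nM.
  rewrite -(wsum_delta M (fun x => tau x * g x)).
  by apply: eq_wsum => x _; rewrite /kern/= /delta0; ring.
rewrite /kern [iter _ _ delta0]/= -/(kern n) Kop_sym; last first.
  by move=> x Mx; rewrite kern_supp// (leq_trans _ Mx)// ltnW.
by rewrite IH ?iterSr// ltnW.
Qed.

Definition hk t : R := pois (fun n => kern n 0) t / tau 0.

Lemma heat_kernelE t : heat_kernel tau t 0 0 = hk t.
Proof.
rewrite /heat_kernel /hk; congr (_ / _); rewrite /trans_prob; apply/cvg_lim => //.
under eq_fun do under eq_bigr do rewrite Kpow00.
by apply: pois_cvg => n; have /andP[a b] := kern01 n 0; rewrite ger0_norm.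
Qed.

(** The heat kernel between 0 and [x] cut to its first [N] Poisson terms. It is finitely supported,
    so summation by parts is exact before [N] tends to infinity. *)
Definition htrunc N t (x : int) : R :=
  (tau 0)^-1 * \sum_(0 <= n < N) pois_weight t n * kern n x.

Lemma htrunc_ge0 N t x : 0 <= t -> 0 <= htrunc N t x.
Proof.
move=> t0; rewrite mulr_ge0 ?invr_ge0 ?(ltW (tau0 0))// sumr_ge0// => n _.
by rewrite mulr_ge0 ?pois_weight_ge0//; have /andP[] := kern01 n x.
Qed.

Lemma htrunc_supp N t x : (N <= `|x|)%N -> htrunc N t x = 0.
Proof.
move=> Nx; rewrite /htrunc big_nat big1 ?mulr0// => n /andP[_ nN].
by rewrite kern_supp ?mulr0//; exact: leq_trans Nx.
Qed.

Lemma kern_abs_le1 n x : `|kern n x| <= 1.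
Proof. by have /andP[a b] := kern01 n x; rewrite ger0_norm. Qed.

Lemma htrunc_cvg t : htrunc N t 0 @[N --> \oo] --> hk t.
Proof.
rewrite /hk mulrC; apply: cvgMr; apply: pois_cvg => n; exact: kern_abs_le1.
Qed.

Lemma htrunc_pairing M N t g : (N <= M)%N ->
  wsum M (fun x => tau x * htrunc N t x * g x) =
  \sum_(0 <= n < N) pois_weight t n * iter n Kop g 0.
Proof.
move=> NM.
transitivity (wsum M (fun x => \sum_(0 <= n < N)
   (tau 0)^-1 * pois_weight t n * (tau x * kern n x * g x))).
  apply: eq_wsum => x _; rewrite /htrunc 2!mulr_sumr mulr_suml.
  by apply: eq_bigr => n _; ring.
rewrite wsum_sum; apply: eq_big_nat => n /andP[_ nN].
by rewrite wsumZ kern_pairing; [field|exact: leq_trans NM].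
Qed.

Lemma Kop_lin (s : seq nat) (c : nat -> R) (F : nat -> int -> R) d x :
  Kop (fun x => d * \sum_(n <- s) c n * F n x) x = d * \sum_(n <- s) c n * Kop (F n) x.
Proof.
rewrite /Kop; elim: s => [|n s IH]; first by rewrite !big_nil; ring.
by rewrite !big_cons !mulrDr -IH; ring.
Qed.

Lemma iter_Kop_htrunc j N t x :
  iter j Kop (htrunc N t) x =
  (tau 0)^-1 * \sum_(0 <= n < N) pois_weight t n * kern (n + j) x.
Proof.
elim: j x => [|j IH] x; first by rewrite /htrunc; under [in RHS]eq_bigr do rewrite addn0.
rewrite iterS.
have -> : iter j Kop (htrunc N t) = (fun z =>
    (tau 0)^-1 * \sum_(0 <= n < N) pois_weight t n * kern (n + j) z).
  by apply/funext => z; exact: IH.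
by rewrite Kop_lin; congr (_ * _); apply: eq_bigr => n _; rewrite addnS.
Qed.

(* The differences [hkS 1 - hkS 0] and [hkS 2 - 2 hkS 1 + hkS 0] are the first two
   time derivatives of [hk]. *)
Definition hkS j t : R := pois (fun n => kern (n + j) 0) t / tau 0.

(** Chapman-Kolmogorov: pairing the kernel at time [t] with itself gives the kernel at time [2 t],
    with [j] additional steps of the chain. *)
Lemma htrunc_energy_cvg j t : 0 <= t ->
  wsum N (fun x => tau x * htrunc N t x * iter j Kop (htrunc N t) x) @[N --> \oo]
  --> hkS j (2 * t).
Proof.
move=> t0; rewrite /hkS mulrC.
rewrite (_ : (fun N => _) = (fun N => (tau 0)^-1 * \sum_(0 <= n < N) \sum_(0 <= m < N)
   pois_weight t n * pois_weight t m * kern (n + m + j) 0)).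
  by apply: cvgMr; apply: (@pois_double_cvg _ (fun n => kern (n + j) 0)) => // n; exact: kern_abs_le1.
apply/funext => N; rewrite htrunc_pairing// mulr_sumr; apply: eq_bigr => n _.
rewrite -iterD iter_Kop_htrunc !mulr_sumr; apply: eq_bigr => m _.
by rewrite (_ : (m + (n + j) = n + m + j)%N); [ring|lia].
Qed.

Lemma hkS0 t : hkS 0 t = hk t.
Proof. by rewrite /hkS /hk; under eq_fun do rewrite addn0. Qed.

Lemma is_derive_hkS j t : is_derive t (1 : R) (hkS j) (hkS j.+1 t - hkS j t).
Proof.
have h := @is_derive_pois R (fun n => kern (n + j) 0) t (fun n => kern_abs_le1 _ _).
have -> : hkS j = (tau 0)^-1 \*: pois (fun n => kern (n + j) 0).
  by apply/funext => z; rewrite /hkS mulrC.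
have := is_deriveZ (tau 0)^-1 h; move=> h'; apply: (is_derive_eq h').
rewrite /hkS /GRing.scale/= mulrBr; congr (_ - _); rewrite mulrC; congr (_ * _).
by congr (pois _ t); apply/funext => n; rewrite addnS.
Qed.

Lemma hk_ge0 t : 0 <= t -> 0 <= hk t.
Proof.
move=> t0; rewrite divr_ge0 ?(ltW (tau0 0))//; apply: pois_ge0 => // n; exact: kern01.
Qed.

(** In the limit, the difference of the two sides is half the Dirichlet energy of the kernel at time
    [t / 2], hence nonnegative. *)
Lemma hkS1_le t : 0 <= t -> hkS 1 t <= hkS 0 t.
Proof.
move=> t0; have h0 : 0 <= t / 2 by rewrite divr_ge0.
have e : 2 * (t / 2) = t by field.
have c0 := htrunc_energy_cvg 0 _ h0; have c1 := htrunc_energy_cvg 1 _ h0.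
rewrite e in c0 c1; rewrite -(cvg_lim _ c0)// -(cvg_lim _ c1)//.
apply: ler_lim; [by apply/cvg_ex; eexists; exact: c1|by apply/cvg_ex; eexists; exact: c0|].
apply: nearW => N; rewrite -subr_ge0 -mulN1r -wsumZ -wsumD.
set f := htrunc N (t / 2).
rewrite [X in 0 <= X](_ : _ = wsum N (fun x => tau x * f x * (f x - Kop f x))); last first.
  by apply: eq_wsum => x _ /=; ring.
have := dirichlet N f (htrunc_supp N (t / 2)).
have : 0 <= wsum N (fun x => (f (x + 1) - f x) ^+ 2).
  by apply: wsum_ge0 => x; exact: sqr_ge0.
by move=> + h; rewrite h; lra.
Qed.

(** By symmetry the second difference is the limit of the squared norms of [Kop h - h] in the space
    weighted by [tau], with [h] the truncated kernel at time [t / 2]. *)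
Lemma hkS_convex t : 0 <= t -> 0 <= hkS 2 t - 2 * hkS 1 t + hkS 0 t.
Proof.
move=> t0; have h0 : 0 <= t / 2 by rewrite divr_ge0.
have e : 2 * (t / 2) = t by field.
have c0 := htrunc_energy_cvg 0 _ h0; have c1 := htrunc_energy_cvg 1 _ h0.
have c2 := htrunc_energy_cvg 2 _ h0; rewrite e in c0 c1 c2.
have c : wsum N (fun x => tau x * htrunc N (t / 2) x * iter 2 Kop (htrunc N (t / 2)) x)
 - 2 * wsum N (fun x => tau x * htrunc N (t / 2) x * iter 1 Kop (htrunc N (t / 2)) x)
 + wsum N (fun x => tau x * htrunc N (t / 2) x * iter 0 Kop (htrunc N (t / 2)) x)
  @[N --> \oo] --> hkS 2 t - 2 * hkS 1 t + hkS 0 t.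
  by apply: cvgD => //; apply: cvgB => //; apply: cvgMr.
rewrite -(cvg_lim _ c)//; apply: limr_ge; first by apply/cvg_ex; eexists; exact: c.
apply: nearW => N /=; rewrite -mulNr -!wsumZ.
set h := htrunc N (t / 2).
have -> : wsum N (fun x => tau x * h x * Kop (Kop h) x) =
  wsum N (fun x => tau x * Kop h x * Kop h x) by rewrite Kop_sym//; exact: htrunc_supp.
rewrite -!wsumD; apply: wsum_ge0 => x.
rewrite (_ : _ + _ = tau x * (Kop h x - h x) ^+ 2); last by ring.
by rewrite mulr_ge0 ?sqr_ge0// ltW.
Qed.

End Chain.

(** * Heat kernel bounds in a fixed environment *)

Section HeatKernelBounds.
Context {R : realType}.
Variable tau : int -> R.
Hypothesis tau1 : forall x, 1 <= tau x.
Implicit Types (f g : int -> R) (M N n m r : nat) (s t : R).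

Let tau0 x : 0 < tau x. Proof. exact: lt_le_trans (tau1 x). Qed.
Let tauN x : tau x != 0. Proof. by rewrite gt_eqF. Qed.
Notation hk := (hk tau).
Notation hkS := (hkS tau).
Notation Kop := (Kop tau).
Notation htrunc := (htrunc tau).

Lemma wsum_tau_gt0 r : 0 < wsum r tau.
Proof.
by rewrite ltr_wpDr// sumr_ge0// => i _; rewrite addr_ge0// ltW.
Qed.

Lemma continuous_hkS j (a b : R) : {within `[a, b], continuous (hkS j)}.
Proof.
apply: derivable_within_continuous => x _.
by have [] := is_derive_hkS tau tau1 j x.
Qed.

Lemma hk_nonincreasing (a b : R) : 0 <= a -> a <= b -> hk b <= hk a.
Proof.
move=> a0; rewrite le_eqVlt => /predU1P[->//|ab].
have [c cab E] := @MVT _ (hkS 0) (fun x => hkS 1 x - hkS 0 x) a b ab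
  (fun x _ => is_derive_hkS tau tau1 0 x) (continuous_hkS 0 a b).
rewrite -subr_le0 -!hkS0 E mulr_le0_ge0 ?subr_ge0 ?(ltW ab)// subr_le0.
by apply: hkS1_le => //; move: cab; rewrite in_itv/= => /andP[/ltW/(le_trans a0)].
Qed.

(** The decrease of [hk] over [[t, 2 t]] is [t] times minus the derivative at some [c]. By convexity
    this is at least [t] times minus the derivative at [2 t], and it is at most [hk t] because [hk]
    stays nonnegative. *)
Lemma dissipation_bound t : 0 < t -> (hkS 0 (2 * t) - hkS 1 (2 * t)) * t <= hk t.
Proof.
move=> t0.
have tt : t < 2 * t by lra.
have [c + E] := @MVT _ (hkS 0) (fun x => hkS 1 x - hkS 0 x) t (2 * t) tt
  (fun x _ => is_derive_hkS tau tau1 0 x) (continuous_hkS 0 _ _).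
rewrite in_itv/= => /andP[tc c2t].
pose g x := hkS 0 x - hkS 1 x.
have dg x : is_derive x (1 : R) g (- (hkS 2 x - 2 * hkS 1 x + hkS 0 x)).
  have := is_deriveB (is_derive_hkS tau tau1 0 x) (is_derive_hkS tau tau1 1 x).
  by move=> h; apply: (is_derive_eq h); ring.
have cg : {within `[c, 2 * t], continuous g}.
  by apply: derivable_within_continuous => x _; have [] := dg x.
have [e + E'] := @MVT _ g _ c (2 * t) c2t (fun x _ => dg x) cg.
rewrite in_itv/= => /andP[ce e2t].
have gle : g (2 * t) <= g c.
  rewrite -subr_le0 E' mulNr oppr_le0 mulr_ge0 ?subr_ge0 ?(ltW c2t)//.
  by apply: hkS_convex => //; lra.
have h2 : 0 <= hk (2 * t) by apply: hk_ge0 => //; lra.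
have : g (2 * t) * t <= g c * t by rewrite ler_wpM2r// ltW.
move: E; rewrite !hkS0 (_ : 2 * t - t = t); last by ring.
by rewrite /g !hkS0 => E; move: h2; rewrite -[hk (2 * t)](subrK (hk t)) E; lra.
Qed.

Lemma hk_upper r t : 0 < t -> hk t <= 2 / wsum r tau + 2 * r%:R / t.
Proof.
move=> t0; have tge := ltW t0; have V0 := wsum_tau_gt0 r.
(* With this choice the energy term is at most [hk t / 2] by [dissipation_bound], and the left-hand
   side absorbs it. *)
pose e : R := 2 / t.
have e0 : 0 < e by rewrite divr_gt0.
pose D N := wsum N (fun x => (htrunc N t (x + 1) - htrunc N t x) ^+ 2).
have Dcvg : D @ \oo --> 2 * (hkS 0 (2 * t) - hkS 1 (2 * t)).
  have c0 := htrunc_energy_cvg tau tau1 0 _ tge.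
  have c1 := htrunc_energy_cvg tau tau1 1 _ tge.
  rewrite (_ : D = (fun N => 2 *
   (wsum N (fun x => tau x * htrunc N t x * iter 0 Kop (htrunc N t) x) -
    wsum N (fun x => tau x * htrunc N t x * iter 1 Kop (htrunc N t) x)))).
    by apply: cvgMr; apply: cvgB.
  apply/funext => N; rewrite /D (dirichlet tau tau1); last exact: htrunc_supp.
  by congr (2 * _); rewrite -mulN1r -wsumZ -wsumD; apply: eq_wsum => x _ /=; ring.
have fin N : (r <= N)%N -> htrunc N t 0 <= (wsum r tau)^-1 + r%:R * (e / 2) + D N / (2 * e).
  move=> rN; set c := r%:R * (e / 2) + D N / (2 * e).
  (* The kernel has total mass at most 1; integrating the path bound against [tau] over [[-r, r]]
     then isolates the value at 0. *)
  have mass : wsum N (fun x => tau x * htrunc N t x) <= 1.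
    rewrite (@eq_wsum _ _ _ (fun x => tau x * htrunc N t x * (fun=> 1) x)).
      rewrite (htrunc_pairing tau tau1)//.
      under eq_bigr do rewrite (iter_Kop_cst tau tau1) mulr1.
      exact: sum_pois_weight_le1.
    by move=> x _; rewrite mulr1.
  have : wsum r (fun x => (htrunc N t 0 - c) * tau x) <= 1.
    apply: le_trans mass.
    apply: (@le_trans _ _ (wsum r (fun x => tau x * htrunc N t x))).
      apply: ler_wsum => x xr; rewrite mulrC ler_wpM2l ?(ltW (tau0 x))//.
      have := @wsum_path _ N r (htrunc N t) e x e0 xr rN.
      by rewrite /c /D; lra.
    by apply: wsum_mono => // x; rewrite mulr_ge0 ?(ltW (tau0 x))// htrunc_ge0.
  rewrite wsumZ -ler_pdivlMr// div1r.
  by rewrite /c; lra.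
have lim : hk t <= (wsum r tau)^-1 + r%:R * (e / 2)
    + 2 * (hkS 0 (2 * t) - hkS 1 (2 * t)) / (2 * e).
  have h1 := htrunc_cvg tau tau1 t.
  have h2 : ((wsum r tau)^-1 + r%:R * (e / 2) + D N / (2 * e)) @[N --> \oo] -->
     (wsum r tau)^-1 + r%:R * (e / 2) + 2 * (hkS 0 (2 * t) - hkS 1 (2 * t)) / (2 * e).
    by apply: cvgD; [exact: cvg_cst|apply: cvgMl].
  rewrite -(cvg_lim _ h1)// -(cvg_lim _ h2)//; apply: ler_lim.
  - by apply/cvg_ex; eexists; exact: h1.
  - by apply/cvg_ex; eexists; exact: h2.
  - by exists r => // N /= rN; exact: fin.
have := dissipation_bound t t0.
set E := hkS 0 _ - _ in lim *.
have eE : 2 * E / (2 * e) = E * t / 2 by rewrite /e; field; rewrite gt_eqF.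
have -> : 2 / wsum r tau + 2 * r%:R / t = 2 * ((wsum r tau)^-1 + r%:R * (e / 2)).
  by rewrite /e; field; rewrite !gt_eqF.
move: lim; rewrite eE.
by lra.
Qed.

Lemma hk_lower (H : int -> R) r s : 0 < s ->
  (forall x, 0 <= H x) -> H 0 = 0 -> (forall x, Kop H x <= H x + 1) ->
  (forall x, (r < `|x|)%N -> 2 * s <= H x) ->
  (4 * wsum r tau)^-1 <= hk (2 * s).
Proof.
move=> s0 H0 H00 KH Hs; have sge := ltW s0; have V0 := wsum_tau_gt0 r.
pose B (x : int) : R := (`|x| <= r)%N%:R.
have sN : s != 0 by rewrite gt_eqF.
(* Markov's inequality for [H]: its expectation grows by at most 1 per step, and it is at least
   [2 s] wherever [B] vanishes. *)
have iterB n x : 1 - (H x + n%:R) / (2 * s) <= iter n Kop B x.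
  elim: n x => [|n IH] x.
    rewrite /= addr0 /B; case: leqP => h /=.
      by rewrite gerBl divr_ge0// mulr_ge0.
    by rewrite subr_le0 ler_pdivlMr ?mul1r ?Hs// mulr_gt0.
  have := ler_Kop tau tau1 _ _ IH x; rewrite -iterS; apply: le_trans.
  have -> : Kop (fun x => 1 - (H x + n%:R) / (2 * s)) x = 1 - (Kop H x + n%:R) / (2 * s).
    by rewrite /Kop; field; rewrite tauN sN.
  rewrite lerD2l lerN2 ler_wpM2r ?invr_ge0 ?mulr_ge0//.
  by rewrite -natr1; have := KH x; lra.
pose w N := \sum_(0 <= n < N) pois_weight s n.
(* The truncated Poisson mean over [N + 1] terms equals [s * w N], since its term at 0 vanishes and
   the others shift by one. Hence the two different indices. *)
have massB N : w N.+1 - 2^-1 * w N <= wsum N.+1 (fun x => tau x * htrunc N.+1 s x * B x).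
  rewrite (htrunc_pairing tau tau1)//.
  apply: (@le_trans _ _ (\sum_(0 <= n < N.+1) pois_weight s n * (1 - n%:R / (2 * s)))).
    rewrite (_ : _ * w N = \sum_(0 <= n < N.+1) pois_weight s n * (n%:R / (2 * s))).
      by rewrite /w -sumrB; apply: ler_sum => n _; rewrite mulrBr mulr1.
    rewrite big_nat_recl// mul0r mulr0 add0r mulr_sumr; apply: eq_bigr => n _.
    rewrite /pois_weight factS natrM exprS.
    have h1 : n.+1%:R != 0 :> R by rewrite pnatr_eq0.
    have h2 : n`!%:R != 0 :> R by rewrite pnatr_eq0 -lt0n fact_gt0.
    by field; rewrite h2 sN addrC natr1 h1.
  apply: ler_sum => n _; rewrite ler_wpM2l ?pois_weight_ge0//.
  by have := iterB n 0; rewrite H00 add0r.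
(* Cauchy-Schwarz in the form [h ^ 2 >= 2 al h - al ^ 2]; this [al] is optimal when [[-r, r]]
   carries mass 1/2. *)
pose al : R := (2 * wsum r tau)^-1.
have al0 : 0 <= al by rewrite invr_ge0 mulr_ge0// ltW.
have fin N : (r <= N.+1)%N ->
   2 * al * (w N.+1 - 2^-1 * w N) - al ^+ 2 * wsum r tau <=
   wsum N.+1 (fun x => tau x * htrunc N.+1 s x * htrunc N.+1 s x).
  move=> rN.
  apply: (@le_trans _ _ (2 * al * wsum N.+1 (fun x => tau x * htrunc N.+1 s x * B x)
     - al ^+ 2 * wsum r tau)).
    by rewrite lerD2r ler_wpM2l// mulr_ge0.
  rewrite -(@wsum_restrict _ r N.+1 tau)// -mulNr -!wsumZ -wsumD.
  apply: ler_wsum => x _; rewrite /B; case: (_ <= _)%N; rewrite ?mulr1 ?mulr0.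
    rewrite -subr_ge0 (_ : _ - _ = tau x * (htrunc N.+1 s x - al) ^+ 2); last by ring.
    by rewrite mulr_ge0 ?sqr_ge0// ltW.
  by rewrite addr0 -mulrA mulr_ge0 ?(ltW (tau0 x))// -expr2 sqr_ge0.
have h1 : (2 * al * (w N.+1 - 2^-1 * w N) - al ^+ 2 * wsum r tau) @[N --> \oo] -->
   2 * al * (1 - 2^-1 * 1) - al ^+ 2 * wsum r tau.
  have cw : w N @[N --> \oo] --> (1 : R) by exact: sum_pois_weight_cvg.
  have cw1 : w N.+1 @[N --> \oo] --> (1 : R) by rewrite (cvg_shiftS w).
  apply: cvgB; last exact: cvg_cst.
  by apply: cvgMr; apply: cvgB => //; apply: cvgMr.
have h2 : wsum N.+1 (fun x => tau x * htrunc N.+1 s x * htrunc N.+1 s x) @[N --> \oo] --> hk (2 * s).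
  have := htrunc_energy_cvg tau tau1 0 _ sge; rewrite hkS0.
  by rewrite -(cvg_shiftS (fun N => wsum N _)).
have -> : (4 * wsum r tau)^-1 = 2 * al * (1 - 2^-1 * 1) - al ^+ 2 * wsum r tau.
  by rewrite /al; field; rewrite gt_eqF.
rewrite -(cvg_lim _ h1)// -(cvg_lim _ h2)//; apply: ler_lim.
- by apply/cvg_ex; eexists; exact: h1.
- by apply/cvg_ex; eexists; exact: h2.
- by exists r => // N /= rN; apply: fin; exact: leqW.
Qed.

(** * A Lyapunov function built from partial sums of the environment *)

Definition rsum n : R := \sum_(0 <= i < n) tau i.+1%:Z.
Definition lsum n : R := \sum_(0 <= i < n) tau (- i.+1%:Z).

Lemma wsum_tauE r : wsum r tau = tau 0 + rsum r + lsum r.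
Proof. by rewrite /wsum big_split/= addrA. Qed.

(** The function [H] of the lower bound: its second difference is [2 tau x] off 0 and zero at 0, so
    one step raises its mean by 1 off 0. As [Negz n] is [-(n + 1)], the left sum has [n + 1]
    terms. *)
Definition lyap (x : int) : R :=
  match x with
  | Posz n => 2 * \sum_(0 <= j < n) rsum j
  | Negz n => 2 * \sum_(0 <= j < n.+1) lsum j
  end.

Lemma lyap0 : lyap 0 = 0.
Proof. by rewrite -[0]/(0%N%:Z) /lyap big_geq ?mulr0. Qed.

Lemma lyapN n : lyap (- n%:Z) = 2 * \sum_(0 <= j < n) lsum j.
Proof. by case: n => [|//]; rewrite oppr0 /= !big_geq. Qed.

Lemma rsum_ge0 n : 0 <= rsum n.
Proof. by apply: sumr_ge0 => i _; exact: ltW. Qed.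

Lemma lsum_ge0 n : 0 <= lsum n.
Proof. by apply: sumr_ge0 => i _; exact: ltW. Qed.

Lemma lyap_ge0 x : 0 <= lyap x.
Proof.
by case: x => n; rewrite mulr_ge0// sumr_ge0// => i _; [exact: rsum_ge0|exact: lsum_ge0].
Qed.

Lemma Kop_lyap x : Kop lyap x <= lyap x + 1.
Proof.
have rS n : rsum n.+1 = rsum n + tau n.+1%:Z by rewrite /rsum big_nat_recr.
have lS n : lsum n.+1 = lsum n + tau (- n.+1%:Z) by rewrite /lsum big_nat_recr.
have r0 : rsum 0 = 0 by rewrite /rsum big_geq.
have l0 : lsum 0 = 0 by rewrite /lsum big_geq.
have rstep n : lyap n.+1%:Z = lyap n%:Z + 2 * rsum n.
  by rewrite /lyap big_nat_recr//= mulrDr.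
have lstep n : lyap (- n.+1%:Z) = lyap (- n%:Z) + 2 * lsum n.
  by rewrite !lyapN big_nat_recr//= mulrDr.
have KE y : Kop lyap y = lyap y + (2 * tau y)^-1 * (lyap (y + 1) - 2 * lyap y + lyap (y - 1)).
  by rewrite /Kop; field.
rewrite KE lerD2l.
have key : lyap (x + 1) - 2 * lyap x + lyap (x - 1) <= 2 * tau x.
  have [|n|n] := intP x.
  - have -> : 0 + 1 = 1%N%:Z by [].
    have -> : 0 - 1 = - 1%N%:Z by [].
    rewrite rstep lstep oppr0 r0 l0 (_ : _ + _ = 0) ?mulr_ge0 ?(ltW (tau0 _))//.
    by rewrite lyap0; ring.
  - have -> : n.+1%:Z + 1 = n.+2%:Z by lia.
    have -> : n.+1%:Z - 1 = n%:Z by lia.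
    by rewrite (rstep n.+1) (rstep n) rS le_eqVlt; apply/orP; left; apply/eqP; ring.
  - have -> : - n.+1%:Z + 1 = - n%:Z by lia.
    have -> : - n.+1%:Z - 1 = - n.+2%:Z by lia.
    by rewrite (lstep n.+1) (lstep n) lS le_eqVlt; apply/orP; left; apply/eqP; ring.
have := tau0 x => tx.
by rewrite mulrC ler_pdivrMr ?mul1r// mulr_gt0.
Qed.

(** Only the block of indices from [m] to [2 m - 1] is kept; each of its [m] terms is at least
    [S m]. *)
Lemma sum_monotone_ge (S : nat -> R) m n : (forall i j, (i <= j)%N -> S i <= S j) ->
  (forall i, 0 <= S i) -> (2 * m <= n)%N -> m%:R * S m <= \sum_(0 <= j < n) S j.
Proof.
move=> Sm S0 mn.
rewrite (@big_cat_nat _ _ _ m)/=; [|lia..].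
rewrite (@big_cat_nat _ _ _ (2 * m)%N _ n)/=; [|lia..].
rewrite addrA addrAC ler_wpDl//.
  by rewrite addr_ge0// sumr_ge0.
apply: (@le_trans _ _ (\sum_(m <= i < 2 * m) S m)).
  by rewrite sumr_const_nat mulr_natl (_ : (2 * m - m)%N = m)//; lia.
by apply: ler_sum_nat => i /andP[mi _]; exact: Sm.
Qed.

Lemma hk_lower_dyadic r m s : 0 < s -> (2 * m <= r)%N ->
  s <= m%:R * rsum m -> s <= m%:R * lsum m -> (4 * wsum r tau)^-1 <= hk (2 * s).
Proof.
move=> s0 mr hr hl; apply: (@hk_lower lyap) => //.
- exact: lyap_ge0.
- exact: lyap0.
- exact: Kop_lyap.
have rmono (i j : nat) : (i <= j)%N -> rsum i <= rsum j.
  move=> ij; rewrite /rsum (@big_cat_nat _ _ _ i _ j)//= lerDl.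
  by apply: sumr_ge0 => k _; exact: ltW.
have lmono (i j : nat) : (i <= j)%N -> lsum i <= lsum j.
  move=> ij; rewrite /lsum (@big_cat_nat _ _ _ i _ j)//= lerDl.
  by apply: sumr_ge0 => k _; exact: ltW.
case=> n rn; rewrite /lyap ler_wpM2l//.
  apply: le_trans hr _; apply: sum_monotone_ge => //; first exact: rsum_ge0.
  by apply: leq_trans mr _; exact: ltnW.
apply: le_trans hl _; apply: sum_monotone_ge => //; first exact: lsum_ge0.
by apply: leq_trans mr _; rewrite NegzE abszN in rn; exact: ltnW.
Qed.

End HeatKernelBounds.

(** * Sums of heavy-tailed variables *)

Section Expectation.
Context {d : measure_display} {T : measurableType d} {R : realType}.
Variable P : probability T R.
Implicit Types (f g : T -> R) (r : R).

(** Measurability, integrability and the value of the integral are bundled so that they pass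
    together through linear combinations. *)
Definition has_mean f r := [/\ measurable_fun setT f,
  P.-integrable setT (EFin \o f) & (\int[P]_t (f t)%:E = r%:E)%E].

Lemma has_mean_cst r : has_mean (fun=> r) r.
Proof.
split; first exact: measurable_cst.
  by apply: finite_measure_integrable_cst.
by have := expectation_cst P r; rewrite unlock.
Qed.

Lemma has_mean_indic (A : set T) : measurable A ->
  has_mean (\1_A : T -> R) (fine (P A)).
Proof.
move=> mA; split; first exact: measurable_indic.
  by apply: integrable_indic.
by rewrite integral_indic// setIT fineK// fin_num_measure.
Qed.

Lemma has_meanD f g r s : has_mean f r -> has_mean g s ->
  has_mean (fun t => f t + g t) (r + s).
Proof.
move=> [mf If Ef] [mg Ig Eg]; split; first exact: measurable_funD.
  by apply: (integrableD measurableT If Ig).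
by rewrite integralD_EFin// Ef Eg EFinD.
Qed.

Lemma has_meanZ f c r : has_mean f r -> has_mean (fun t => c * f t) (c * r).
Proof.
move=> [mf If Ef]; split; first exact: measurable_funM.
  by apply: (integrableZl measurableT c If).
rewrite (_ : (fun t => _) = (fun t => c%:E * (EFin \o f) t)%E); last first.
  by apply/funext => t; rewrite EFinM.
by rewrite integralZl// Ef EFinM.
Qed.

Lemma has_mean_sum (I : Type) (s : seq I) (F : I -> T -> R) (m : I -> R) :
  (forall i, has_mean (F i) (m i)) ->
  has_mean (fun t => \sum_(i <- s) F i t) (\sum_(i <- s) m i).
Proof.
move=> h; elim: s => [|i s IH].
  rewrite big_nil (_ : (fun t => _) = (fun=> 0)); last by apply/funext => t; rewrite big_nil.
  exact: has_mean_cst.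
rewrite big_cons (_ : (fun t => _) = (fun t => F i t + \sum_(j <- s) F j t)).
  exact: has_meanD.
by apply/funext => t; rewrite big_cons.
Qed.

(** Chebyshev's inequality through the second moment: squaring a centred combination of indicators
    yields a finite double sum of covariances of events. *)
Lemma chebyshev_indic (I : Type) (s : seq I) (A : I -> set T) (w : I -> R) (c : R) :
  (forall i, measurable (A i)) -> 0 < c ->
  let Y t := \sum_(i <- s) w i * (\1_(A i) t - fine (P (A i))) in
  measurable [set t | c <= `|Y t|] /\
  (P [set t | (c <= `|Y t|)%R] <=
   (c ^- 2 * \sum_(i <- s) \sum_(j <- s) w i * w j *
     (fine (P (A i `&` A j)) - fine (P (A i)) * fine (P (A j))))%:E)%E.
Proof.
move=> mA c0 Y.
have [mY _ _] : has_mean Y (\sum_(i <- s) w i * (fine (P (A i)) - fine (P (A i)))).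
  apply: has_mean_sum => i; apply: has_meanZ.
  by apply: has_meanD; [exact: has_mean_indic|exact: has_mean_cst].
have mS : measurable [set t | c <= `|Y t|].
  rewrite (_ : [set t | _] = (fun t => `|Y t|) @^-1` `[c, +oo[%classic); last first.
    by apply/seteqP; split => t /=; rewrite in_itv/= andbT.
  rewrite -[X in measurable X]setTI.
  by apply: (measurableT_comp (@normr_measurable R setT) mY) => //; exact: measurable_itv.
split => //.
set V := \sum_(i <- s) _.
have [mY2 iY2 EY2] : has_mean (fun t => Y t ^+ 2) V.
  rewrite (_ : (fun t => _) = (fun t => \sum_(i <- s) \sum_(j <- s) w i * w j *
     (\1_(A i `&` A j) t + (- fine (P (A j)) * \1_(A i) t +
       (- fine (P (A i)) * \1_(A j) t + fine (P (A i)) * fine (P (A j))))))); last first.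
    apply/funext => t; rewrite expr2 /Y mulr_suml; apply: eq_bigr => i _.
    by rewrite mulr_sumr; apply: eq_bigr => j _; rewrite indicI/=; ring.
  rewrite /V; apply: has_mean_sum => i; apply: has_mean_sum => j; apply: has_meanZ.
  rewrite (_ : _ - _ = fine (P (A i `&` A j)) + (- fine (P (A j)) * fine (P (A i)) +
    (- fine (P (A i)) * fine (P (A j)) + fine (P (A i)) * fine (P (A j))))); last by ring.
  apply: has_meanD; first by apply: has_mean_indic; exact: measurableI.
  apply: has_meanD; first by apply: has_meanZ; exact: has_mean_indic.
  apply: has_meanD; first by apply: has_meanZ; exact: has_mean_indic.
  exact: has_mean_cst.
have [m1 i1 E1] := has_meanZ _ (c ^+ 2) _ (has_mean_indic _ mS).
have le12 : c ^+ 2 * fine (P [set t | c <= `|Y t|]) <= V.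
  rewrite -lee_fin -E1 -EY2; apply: ge0_le_integral => //.
  - by move=> t _; rewrite lee_fin mulr_ge0 ?sqr_ge0// indicE.
  - exact/measurable_EFinP.
  - exact/measurable_EFinP.
  move=> t _; rewrite lee_fin indicE.
  have [|] := boolP (t \in _); rewrite ?mulr0 ?sqr_ge0// inE/= mulr1 => h.
  by rewrite -[Y t ^+ 2]real_normK ?num_real// lerXn2r// ?nnegrE ?(ltW c0).
rewrite -[leLHS]fineK ?fin_num_measure// lee_fin mulrC.
by rewrite ler_pdivlMr ?exprn_gt0// mulrC.
Qed.

(** The first Borel-Cantelli lemma, with summability certified by a telescoping majorant: the
    probabilities sum to at most [g 0]. *)
Lemma borel_cantelli_ae (F : nat -> set T) (b g : nat -> R) :
  (forall k, measurable (F k)) -> (forall k, (P (F k) <= (b k)%:E)%E) ->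
  (forall k, 0 <= g k) -> (forall k, b k <= g k - g k.+1) ->
  {ae P, forall t, exists K, forall k, (K <= k)%N -> ~ F k t}.
Proof.
move=> mF Fb g0 bg.
have h0 : P (lim_sup_set F) = 0%E.
  apply: lim_sup_set_cvg0 => //.
  apply: (@le_lt_trans _ _ (g 0%N)%:E); last by rewrite ltry.
  apply: lime_le; first by apply: is_cvg_nneseries => n _ _; exact: measure_ge0.
  apply: nearW => N /=.
  apply: (@le_trans _ _ (\sum_(0 <= k < N) (b k)%:E)%E); first exact: lee_sum.
  rewrite sumEFin lee_fin.
  apply: (@le_trans _ _ (\sum_(0 <= k < N) (g k - g k.+1))); first exact: ler_sum.
  have -> : \sum_(0 <= k < N) (g k - g k.+1) = g 0%N - g N.
    by rewrite -[RHS]opprK opprB -telescope_sumr// -sumrN; apply: eq_bigr => i _; rewrite opprB.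
  by rewrite gerBl.
exists (lim_sup_set F); split => //.
  apply: bigcap_measurable => // k _; exact: bigcup_measurable.
move=> t /= h K _; apply: contrapT => hK.
by apply: h; exists K => k Kk Fk; apply: hK; exists k.
Qed.

End Expectation.

Section DyadicTruncation.
Context {R : realType}.
Implicit Types (y : R).

(* A stand-in for [min y (2^J)], up to a factor 2: being a combination of indicators,
   its second moments only involve probabilities of tail events. *)
Definition dyadic J y : R := \sum_(0 <= j < J) 2 ^+ j * (2 ^+ j < y)%R%:R.

Lemma sum_pow2 J : \sum_(0 <= j < J) 2 ^+ j = 2 ^+ J - 1 :> R.
Proof.
elim: J => [|J IH]; first by rewrite big_geq// expr0 subrr.
by rewrite big_nat_recr//= IH exprS; ring.
Qed.

Lemma dyadic_le J y : dyadic J y <= 2 ^+ J - 1.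
Proof.
rewrite -sum_pow2; apply: ler_sum => j _.
by case: ltP => _; rewrite ?mulr1 ?mulr0// exprn_ge0.
Qed.

Lemma dyadic_lb J y : 0 <= y -> dyadic J y <= 2 * y.
Proof.
move=> y0; elim: J => [|J IH]; first by rewrite /dyadic big_geq// mulr_ge0.
rewrite /dyadic big_nat_recr//= -/(dyadic J y); case: ltP => h; last by rewrite mulr0 addr0.
by rewrite mulr1; have := dyadic_le J y; lra.
Qed.

Lemma dyadic_full J y : 2 ^+ J < y -> dyadic J y = 2 ^+ J - 1.
Proof.
move=> h; rewrite -sum_pow2; apply: eq_big_nat => j /andP[_ jJ].
rewrite (lt_trans _ h) ?mulr1// ltr_eXn2l// ?ltr1n//.
Qed.

Lemma dyadic_ub J y : y <= 2 ^+ J -> y <= 1 + dyadic J y.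
Proof.
elim: J => [|J IH] h; first by rewrite expr0 in h; rewrite /dyadic big_geq// addr0.
rewrite /dyadic big_nat_recr//= -/(dyadic J y); case: (ltP (2 ^+ J) y) => hy.
  rewrite (dyadic_full _ _ hy) mulr1; move: h; rewrite exprS; lra.
by rewrite mulr0 addr0; exact: IH.
Qed.

(** For a variable with tail [1 / u], this double sum is the second moment of [dyadic J]: the pair
    [(j, l)] contributes [2 ^ (j + l)] times the probability [2 ^ - max j l]. *)
Lemma sum_pow2_min J :
  \sum_(0 <= j < J) \sum_(0 <= l < J) 2 ^+ minn j l <= 3 * 2 ^+ J :> R.
Proof.
elim: J => [|J IH]; first by rewrite big_geq// mulr_ge0.
rewrite big_nat_recr//= (@big_nat_recr _ _ _ J)//=.
under eq_bigr do rewrite big_nat_recr//=.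
rewrite big_split/= minnn.
have -> : \sum_(0 <= i < J) 2 ^+ minn i J = 2 ^+ J - 1 :> R.
  by rewrite -sum_pow2; apply: eq_big_nat => i /andP[_ iJ]; rewrite (minn_idPl (ltnW iJ)).
have -> : \sum_(0 <= i < J) 2 ^+ minn J i = 2 ^+ J - 1 :> R.
  by rewrite -sum_pow2; apply: eq_big_nat => i /andP[_ iJ]; rewrite (minn_idPr (ltnW iJ)).
rewrite exprS; move: IH; have : (0 : R) <= 2 ^+ J by rewrite exprn_ge0.
by lra.
Qed.

Lemma pow2_between (x : R) : 1 <= x -> exists m : nat, x <= 2 ^+ m <= 2 * x.
Proof.
move=> x1.
have ex : exists m : nat, x <= 2 ^+ m.
  exists (Num.truncn x).+1; apply: ltW.
  apply: (lt_le_trans (real_truncnS_gt (num_real x))).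
  by rewrite -natrX ler_nat ltnW// ltn_expl.
exists (ex_minn ex); case: ex_minnP => m hm hmin; rewrite hm/=.
case: m hm hmin => [|m] hm hmin; first by rewrite expr0; lra.
rewrite exprS ler_pM2l//; apply: ltW; rewrite ltNge; apply/negP => /hmin.
by rewrite ltnn.
Qed.

End DyadicTruncation.

(** * Strong bounds for sums of pairwise independent variables with tail [1 / u] *)

Section HeavyTailSums.
Context {d : measure_display} {T : measurableType d} {R : realType}.
Variable P : probability T R.
Variable X : nat -> T -> R.
Hypothesis mX : forall i, measurable_fun setT (X i).
Hypothesis indepX : forall i j (u v : R), i != j ->
  P ([set w | u < X i w] `&` [set w | v < X j w]) =
  (P [set w | (u < X i w)%R] * P [set w | (v < X j w)%R])%E.
Hypothesis tailX : forall i (u : R), 1 <= u -> P [set w | u < X i w] = (u^-1)%:E.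

Lemma measurable_tail i (u : R) : measurable [set w | u < X i w].
Proof.
rewrite (_ : [set w | _] = X i @^-1` `]u, +oo[%classic); last first.
  by apply/seteqP; split => t /=; rewrite in_itv/= andbT.
by rewrite -[X in measurable X]setTI; apply: mX => //; exact: measurable_itv.
Qed.

(** Each level contributes [2 ^ j * 2 ^ - j = 1] to the mean, so [dyadic J] has mean [J].
    Covariances between distinct variables vanish, and each variable has variance at most
    [3 * 2 ^ J]. *)
Lemma dyadic_sum_deviation n J (c : R) : 0 < c ->
  measurable [set w | c <= `|\sum_(0 <= i < n) dyadic J (X i w) - n%:R * J%:R|] /\
  (P [set w | (c <= `|\sum_(0 <= i < n) dyadic J (X i w) - n%:R * J%:R|)%R] <=
   (3 * n%:R * 2 ^+ J / c ^+ 2)%:E)%E.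
Proof.
move=> c0.
pose s := [seq (i, j) | i <- index_iota 0 n, j <- index_iota 0 J].
pose A (a : nat * nat) := [set w | 2 ^+ a.2 < X a.1 w].
pose wt (a : nat * nat) : R := 2 ^+ a.2.
have wt0 a : 0 < wt a by rewrite exprn_gt0.
have wt1 a : 1 <= wt a by rewrite exprn_ege1// ler1n.
have mA a : measurable (A a) by exact: measurable_tail.
have pA a : fine (P (A a)) = (wt a)^-1 by rewrite /A tailX//; exact: wt1.
have := @chebyshev_indic _ _ _ P _ s A wt c mA c0.
rewrite (_ : (fun w => \sum_(a <- s) _) =
   (fun w => \sum_(0 <= i < n) dyadic J (X i w) - n%:R * J%:R)); last first.
  apply/funext => w; rewrite /s big_allpairs/=.
  have -> : n%:R * J%:R = \sum_(0 <= i < n) \sum_(0 <= j < J) 1 :> R.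
    by rewrite !sumr_const_nat !subn0 -[RHS]mulr_natl.
  rewrite -sumrB; apply: eq_bigr => i _; rewrite -sumrB; apply: eq_bigr => j _.
  rewrite pA mulrBr mulfV ?gt_eqF// indicE /wt/=; congr (_ * _ - _).
  by rewrite mem_setE.
move=> [mE le]; split => //; apply: (le_trans le); rewrite lee_fin mulrC.
apply: ler_wpM2r; first by rewrite invr_ge0 sqr_ge0.
have cov a b : wt a * wt b * (fine (P (A a `&` A b)) - fine (P (A a)) * fine (P (A b)))
    <= (if a.1 == b.1 then 2 ^+ minn a.2 b.2 else 0).
  case: eqVneq => [ab|ab]; last first.
    have -> : fine (P (A a `&` A b)) = fine (P (A a)) * fine (P (A b)).
      by rewrite -fineM ?fin_num_measure// -indepX.
    by rewrite subrr mulr0.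
  have AE : A a `&` A b = [set w | 2 ^+ maxn a.2 b.2 < X a.1 w].
    apply/seteqP; split => w /=.
      by rewrite /A/= -ab => -[h1 h2]; case: leqP.
    move=> h; rewrite /A/= -ab; split; apply: le_lt_trans h; rewrite ler_eXn2l ?ltr1n//.
      exact: leq_maxl.
    exact: leq_maxr.
  rewrite AE tailX ?exprn_ege1 ?ler1n//= !pA.
  have e : wt a * wt b = 2 ^+ maxn a.2 b.2 * 2 ^+ minn a.2 b.2.
    by rewrite /wt -!exprD; congr (_ ^+ _); lia.
  rewrite mulrBr {1}e mulrAC mulfV ?expf_neq0// mul1r gerBl.
  by rewrite !mulr_ge0 ?invr_ge0 ?ltW.
apply: (@le_trans _ _ (\sum_(a <- s) \sum_(b <- s)
    (if a.1 == b.1 then 2 ^+ minn a.2 b.2 else 0))).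
  by apply: ler_sum => a _; apply: ler_sum => b _; exact: cov.
rewrite /s big_allpairs/=.
under eq_bigr do under eq_bigr do rewrite big_allpairs/=.
apply: (@le_trans _ _ (\sum_(0 <= i < n) 3 * 2 ^+ J)); last first.
  by rewrite sumr_const_nat subn0 -[leLHS]mulr_natl mulrCA mulrA.
apply: ler_sum_nat => i /andP[_ i_n].
apply: le_trans (sum_pow2_min J); apply: ler_sum => j _.
rewrite (bigD1_seq i) ?mem_index_iota ?iota_uniq//= eqxx [X in _ + X]big1 ?addr0//.
by move=> i' /negbTE; rewrite eq_sym => ->; rewrite big1.
Qed.

Lemma inv_sqr_telescope (j : nat) : (j.+1%:R ^+ 2)^-1 <= 2 / j.+1%:R - 2 / j.+2%:R :> R.
Proof.
rewrite -(natr1 j.+1); have : 1 <= j.+1%:R :> R by rewrite ler1n.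
move: (j.+1%:R : R) => a a1.
rewrite (_ : _ - _ = 2 / (a * (a + 1))); last by field; apply/andP; split; apply/eqP; lra.
rewrite ler_pdivlMr ?mulr_gt0; [|lra..].
rewrite (_ : _^-1 * _ = 1 + a^-1); last by field; apply/eqP; lra.
have : a^-1 <= 1 by rewrite invf_le1; lra.
by lra.
Qed.

(** With [n = 2 ^ k] terms truncated at level [k], a deviation by half the mean has probability at
    most [12 / k ^ 2], which is summable. The remaining factor 1/2 comes from [dyadic_lb]. Indexing
    by [j.+1] avoids [k = 0]. *)
Lemma ae_sum_lower : {ae P, forall w, (forall i, 0 <= X i w) ->
  exists K, forall k, (K <= k)%N ->
    2 ^+ k * k%:R / 4 <= \sum_(0 <= i < 2 ^ k) X i w}.
Proof.
pose c j : R := 2 ^+ j.+1 * j.+1%:R / 2.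
have c0 j : 0 < c j by rewrite divr_gt0// mulr_gt0 ?exprn_gt0// ltr0n.
pose F j := [set w | c j <= `|\sum_(0 <= i < 2 ^ j.+1) dyadic j.+1 (X i w)
   - (2 ^ j.+1)%:R * j.+1%:R|].
have : {ae P, forall w, exists K, forall k, (K <= k)%N -> ~ F k w}.
  apply: (@borel_cantelli_ae _ _ _ P F (fun j => 12 / j.+1%:R ^+ 2) (fun j => 24 / j.+1%:R)).
  - by move=> j; have [] := dyadic_sum_deviation (2 ^ j.+1) j.+1 (c j) (c0 j).
  - move=> j; have [_ h] := dyadic_sum_deviation (2 ^ j.+1) j.+1 (c j) (c0 j).
    apply: (le_trans h); rewrite lee_fin /c natrX le_eqVlt; apply/orP; left; apply/eqP.
    by field; rewrite expf_neq0//= addrC natr1 pnatr_eq0.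
  - by move=> k; rewrite divr_ge0.
  - move=> j; have := inv_sqr_telescope j.
    rewrite (_ : 24 / j.+1%:R - 24 / j.+2%:R = 12 * (2 / j.+1%:R - 2 / j.+2%:R)); last by ring.
    by rewrite ler_pM2l.
apply: filterS => w [K hK] X0; exists K.+1 => -[//|j] Kj.
have := hK j Kj; rewrite /F/= => /negP; rewrite -ltNge => h.
have hd : \sum_(0 <= i < 2 ^ j.+1) dyadic j.+1 (X i w) <= 2 * \sum_(0 <= i < 2 ^ j.+1) X i w.
  by rewrite mulr_sumr; apply: ler_sum => i _; exact: dyadic_lb.
move: h; rewrite ltr_norml => /andP[+ _]; rewrite natrX -/(c j).
have -> : 2 ^+ j.+1 * j.+1%:R / 4 = c j / 2 by rewrite /c; field.
have -> : 2 ^+ j.+1 * j.+1%:R = c j * 2 by rewrite /c; field.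
by move: hd; lra.
Qed.

(** Truncate at [2 ^ (k + m)] with [2 ^ m] of order [x]. Some variable exceeds this level with
    probability at most [1 / x], and the truncated sum deviates by [2 ^ k * x] with probability at
    most [6 / x]. Off both events the sum is at most [2 ^ k * (1 + 3 x + x)]. *)
Lemma sum_upper_event k (x : R) : 1 <= x -> k%:R <= x ->
  exists E, [/\ measurable E, (P E <= (7 / x)%:E)%E &
    forall w, ~ E w -> \sum_(0 <= i < 2 ^ k) X i w <= 5 * 2 ^+ k * x].
Proof.
move=> x1 kx; have x0 : 0 < x by exact: lt_le_trans x1.
have [m /andP[xm mx]] := pow2_between x x1.
pose J := (k + m)%N; pose n := (2 ^ k)%N.
have n0 : 0 < n%:R :> R by rewrite ltr0n expn_gt0.
have nE : n%:R = 2 ^+ k :> R by rewrite natrX.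
pose big := \big[setU/set0]_(i < n) [set w | 2 ^+ J < X i w].
have c0 : 0 < n%:R * x by rewrite mulr_gt0.
have [mD leD] := dyadic_sum_deviation n J _ c0.
set D := [set w | _] in mD leD.
have mbig : measurable big by apply: bigsetU_measurable => i _; exact: measurable_tail.
exists (big `|` D); split.
- exact: measurableU.
- apply: (le_trans (measureU2 _ mbig mD)).
  rewrite (_ : 7 / x = 1 / x + 6 / x); last by rewrite -mulrDl; congr (_ / _); lra.
  rewrite EFinD; apply: leeD.
    apply: (@le_trans _ _ (\sum_(i < n) P [set w | (2 ^+ J < X i w)%R])%E).
      have mt i : (i < n)%N -> measurable [set w | 2 ^+ J < X i w].
        by move=> _; exact: measurable_tail.
      exact: (@Boole_inequality _ _ _ P (fun i => [set w | 2 ^+ J < X i w]) n mt).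
    rewrite (eq_bigr (fun=> ((2 ^+ J)^-1)%:E)); last first.
      by move=> i _; rewrite tailX// exprn_ege1// ler1n.
    rewrite sumEFin lee_fin sumr_const card_ord -[leLHS]mulr_natl nE /J exprD.
    rewrite invfM mulrA mulfV ?expf_neq0// !div1r lef_pV2 ?posrE ?exprn_gt0//.
  apply: (le_trans leD); rewrite lee_fin /J exprD -nE.
  rewrite (_ : _ / _ = 3 * 2 ^+ m / x / x); last by field; rewrite !gt_eqF.
  rewrite ler_pM2r ?invr_gt0// ler_pdivrMr//.
  by move: mx; lra.
move=> w /not_orP[nbig /negP]; rewrite -ltNge ltr_norml => /andP[_ h].
have Xle i : (i < n)%N -> X i w <= 2 ^+ J.
  move=> i_n; rewrite leNgt; apply/negP => hi; apply: nbig.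
  by rewrite /big -(bigcup_mkord n (fun i => [set w | 2 ^+ J < X i w])); exists i.
have hd : \sum_(0 <= i < n) X i w <= n%:R + \sum_(0 <= i < n) dyadic J (X i w).
  apply: (@le_trans _ _ (\sum_(0 <= i < n) (1 + dyadic J (X i w)))).
    by apply: ler_sum_nat => i /andP[_ i_n]; apply: dyadic_ub; exact: Xle.
  by rewrite big_split/= sumr_const_nat subn0.
apply: (le_trans hd).
(* The crude bound [m <= 2 ^ m] suffices, since [k <= x] already allows a mean of order [x]. *)
have mle : m%:R <= 2 * x.
  by apply: le_trans mx; rewrite -natrX ler_nat ltnW// ltn_expl.
have Jle : n%:R * J%:R <= n%:R * (3 * x).
  by rewrite ler_pM2l// /J natrD; move: kx mle; lra.
have nx : n%:R <= n%:R * x by rewrite ler_peMr// ltW.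
by rewrite -nE; move: h Jle nx; lra.
Qed.

Lemma ae_sum_upper (e : nat -> nat) (x g : nat -> R) :
  (forall j, 1 <= x j) -> (forall j, (e j)%:R <= x j) ->
  (forall j, 0 <= g j) -> (forall j, 7 / x j <= g j - g j.+1) ->
  {ae P, forall w, exists K, forall j, (K <= j)%N ->
    \sum_(0 <= i < 2 ^ e j) X i w <= 5 * 2 ^+ e j * x j}.
Proof.
move=> x1 ex g0 hg.
have /choice[E hE] : forall j, exists E, [/\ measurable E, (P E <= (7 / x j)%:E)%E &
    forall w, ~ E w -> \sum_(0 <= i < 2 ^ e j) X i w <= 5 * 2 ^+ e j * x j].
  by move=> j; apply: sum_upper_event.
have := @borel_cantelli_ae _ _ _ P E (fun j => 7 / x j) g.
have mE j : measurable (E j) by have [] := hE j.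
have pE j : (P (E j) <= (7 / x j)%:E)%E by have [] := hE j.
move=> /(_ mE pE g0 hg); apply: filterS => w [K hK]; exists K => j Kj.
by have [_ _] := hE j; apply; exact: hK.
Qed.

Lemma ln_le_sub1 (y : R) : 0 < y -> ln y <= y - 1.
Proof.
move=> y0; have := @le_ln1Dx _ (y - 1); rewrite (addrC 1) subrK; apply; lra.
Qed.

Lemma ln_sub_le (a b : R) : 0 < a -> 0 < b -> ln b - ln a <= (b - a) / a.
Proof.
move=> a0 b0; rewrite -ln_div ?posrE//.
apply: (le_trans (ln_le_sub1 _ _)); first by rewrite divr_gt0.
by rewrite mulrBl divff ?gt_eqF.
Qed.

Lemma ln2_ge : 2^-1 <= ln 2 :> R.
Proof.
have := ln_sub_le 2 1 (ltr0Sn _ 1) ltr01; rewrite ln1; lra.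
Qed.

Lemma ln4_ge : 1 <= ln 4 :> R.
Proof.
by rewrite (_ : 4 = 2 * 2) ?lnM ?posrE//; [have := ln2_ge; lra|lra].
Qed.

Lemma ln_nat_ge1 n : (4 <= n)%N -> 1 <= ln n%:R :> R.
Proof.
move=> n4; apply: (le_trans ln4_ge); rewrite ler_ln ?posrE ?ltr0n//.
  by rewrite (ler_nat _ 4).
exact: leq_trans n4.
Qed.

Lemma ln_ge1 (x : R) : 4 <= x -> 1 <= ln x.
Proof.
by move=> x4; apply: (le_trans ln4_ge); rewrite ler_ln ?posrE//; apply: lt_le_trans x4.
Qed.

(** Along all dyadic scales, [1 / (k * ln k ^ 2)] is summable, with [7 / ln] as telescoping
    majorant. The shifts by 4 and 5 keep every logarithm at least 1. *)
Lemma ae_sum_upper_log : {ae P, forall w, exists K, forall k, (K <= k)%N ->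
    \sum_(0 <= i < 2 ^ k) X i w <= 5 * 2 ^+ k * (k%:R * ln k%:R ^+ 2)}.
Proof.
have := @ae_sum_upper (fun j => j + 5)%N (fun j => (j + 5)%:R * ln (j + 5)%:R ^+ 2)
   (fun j => 7 / ln (j + 4)%:R).
have l5 j : 1 <= ln (j + 5)%:R :> R by apply: ln_nat_ge1; lia.
have l4 j : 1 <= ln (j + 4)%:R :> R by apply: ln_nat_ge1; lia.
have j5 j : 5 <= (j + 5)%:R :> R by rewrite (ler_nat _ 5) leq_addl.
have x5 j : (j + 5)%:R <= (j + 5)%:R * ln (j + 5)%:R ^+ 2 :> R.
  by rewrite ler_peMr// exprn_ege1.
have H1 j : 1 <= (j + 5)%:R * ln (j + 5)%:R ^+ 2 :> R.
  by apply: le_trans (x5 j); have := j5 j; lra.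
have H3 j : 0 <= 7 / ln (j + 4)%:R :> R by rewrite divr_ge0//; have := l4 j; lra.
have H4 j : 7 / ((j + 5)%:R * ln (j + 5)%:R ^+ 2) <= 7 / ln (j + 4)%:R - 7 / ln (j.+1 + 4)%:R :> R.
  rewrite addSnnS.
  set a := ln (j + 4)%:R; set b := ln (j + 5)%:R; set y : R := (j + 5)%:R.
  have a1 : 1 <= a by exact: l4.
  have b1 : 1 <= b by exact: l5.
  have y5 : 5 <= y by exact: j5.
  have yE : (j + 4)%:R = y - 1 :> R by apply/eqP; rewrite eq_sym subr_eq natr1 /y; apply/eqP; congr (_%:R); lia.
  have ab : a - b <= - y^-1.
    apply: (le_trans (ln_sub_le _ _ _ _)); [by move: y5; rewrite -/y; lra|by rewrite yE; move: y5; lra|].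
    by rewrite yE -/y (_ : y - 1 - y = -1) ?mulN1r//; ring.
  have yV : 0 < y^-1 by rewrite invr_gt0; lra.
  rewrite (_ : 7 / a - 7 / b = 7 * ((b - a) / (a * b))); last first.
    by field; rewrite !gt_eqF//; lra.
  rewrite ler_pM2l// ler_pdivlMr ?mulr_gt0//; [|lra..].
  rewrite (_ : _ * (a * b) = y^-1 * (a / b)); last first.
    by field; rewrite !gt_eqF//; lra.
  apply: (@le_trans _ _ y^-1); last by lra.
  by rewrite ler_piMr ?(ltW yV)// ler_pdivrMr; lra.
move=> /(_ H1 x5 H3 H4); apply: filterS => w [K hK]; exists (K + 5)%N => k Kk.
have := hK (k - 5)%N; rewrite subnK; last by lia.
by apply; lia.
Qed.

(** Along the sparse scales [k = j ^ 2] the probabilities [7 / k] are already summable, so the bound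
    holds there without a logarithmic loss. *)
Lemma ae_sum_upper_square : {ae P, forall w, exists K, forall j, (K <= j)%N ->
    \sum_(0 <= i < 2 ^ (j ^ 2)) X i w <= 5 * 2 ^+ (j ^ 2) * (j ^ 2)%:R}.
Proof.
have := @ae_sum_upper (fun j => j.+1 ^ 2)%N (fun j => (j.+1 ^ 2)%:R) (fun j => 14 / j.+1%:R).
have H1 j : 1 <= (j.+1 ^ 2)%:R :> R by rewrite ler1n expn_gt0.
have H3 j : 0 <= 14 / j.+1%:R :> R by rewrite divr_ge0.
have H4 j : 7 / (j.+1 ^ 2)%:R <= 14 / j.+1%:R - 14 / j.+2%:R :> R.
  have := inv_sqr_telescope j.
  rewrite (_ : 14 / j.+1%:R - 14 / j.+2%:R = 7 * (2 / j.+1%:R - 2 / j.+2%:R)); last by ring.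
  by rewrite natrX ler_pM2l.
move=> /(_ H1 (fun=> lexx _) H3 H4); apply: filterS => w [K hK]; exists K.+1 => -[//|j] Kj.
exact: hK.
Qed.

End HeavyTailSums.

(** * Almost sure properties of the environment *)

Section LogTriple.
Context {R : realType}.

(** A primitive of [1 / (x * ln x * ln (ln x))]; its divergence drives the second Borel-Cantelli
    argument. *)
Definition ln3 (x : R) : R := ln (ln (ln x)).

Lemma ln16_ge2 (x : R) : 16 <= x -> 2 <= ln x.
Proof.
move=> x16; apply: (@le_trans _ _ (ln 16)).
  rewrite (_ : 16 = 4 * 4) ?lnM ?posrE//; [by have := @ln4_ge R; lra|lra].
by rewrite ler_ln ?posrE//; apply: lt_le_trans x16.
Qed.

Lemma lnln16_ge (x : R) : 16 <= x -> 2^-1 <= ln (ln x).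
Proof.
move=> /ln16_ge2 h; apply: (le_trans (@ln2_ge R)).
by rewrite ler_ln ?posrE//; apply: lt_le_trans h.
Qed.

Lemma ln3_step (x : R) : 16 <= x -> ln3 (x + 1) - ln3 x <= (x * ln x * ln (ln x))^-1.
Proof.
move=> x16; have l1 := ln16_ge2 x x16; have l2 := lnln16_ge x x16.
have x1 : 16 <= x + 1 by lra.
have l1' := ln16_ge2 _ x1; have l2' := lnln16_ge _ x1.
have x0 : 0 < x by lra.
have a1 : ln (x + 1) - ln x <= x^-1.
  by apply: (le_trans (ln_sub_le _ _ _ _)); [lra|lra|rewrite addrAC subrr add0r div1r].
have a2 : ln (ln (x + 1)) - ln (ln x) <= x^-1 / ln x.
  apply: (le_trans (ln_sub_le _ _ _ _)); [lra|lra|].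
  by rewrite ler_wpM2r// invr_ge0; lra.
apply: (le_trans (ln_sub_le _ _ _ _)); [lra|lra|].
by rewrite !invfM ler_wpM2r// invr_ge0; lra.
Qed.

Lemma ln3_unbounded (C : R) (N : nat) : exists2 M : nat, (N <= M)%N & C <= ln3 M%:R.
Proof.
pose y := expR (expR (expR C)).
exists (maxn N (Num.truncn y).+1); first exact: leq_maxl.
have yM : y <= (maxn N (Num.truncn y).+1)%:R.
  apply: (@le_trans _ _ (Num.truncn y).+1%:R); last by rewrite ler_nat leq_maxr.
  exact/ltW/real_truncnS_gt/num_real.
rewrite /ln3 -[C]expRK -[expR C]expRK -[expR (expR C)]expRK -/y.
have y0 : 0 < y by exact: expR_gt0.
have h1 : expR (expR C) <= ln (maxn N (Num.truncn y).+1)%:R.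
  by rewrite -[leLHS]expRK -/y ler_ln// posrE; exact: lt_le_trans yM.
have h2 : expR C <= ln (ln (maxn N (Num.truncn y).+1)%:R).
  by rewrite -[leLHS]expRK ler_ln// posrE ?expR_gt0//; exact: lt_le_trans h1.
rewrite !expRK; rewrite -[leLHS]expRK ler_ln// posrE ?expR_gt0//.
by apply: lt_le_trans h2; exact: expR_gt0.
Qed.

End LogTriple.

Section Environment.
Context {d : measure_display} {T : measurableType d} {R : realType}.
Variable P : probability T R.
Variable tau : int -> T -> R.
Hypothesis mtau : forall x, measurable_fun setT (tau x).
Hypothesis indep : mutually_independent P tau.
Hypothesis tail : forall (x : int) (u : R), 1 <= u -> P [set w | u < tau x w] = (u^-1)%:E.

Lemma measurable_tau_le x (u : R) : measurable [set w | tau x w <= u].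
Proof.
rewrite (_ : [set w | _] = tau x @^-1` `]-oo, u]%classic); last first.
  by apply/seteqP; split => t /=; rewrite in_itv/=.
by rewrite -[X in measurable X]setTI; apply: mtau => //; exact: measurable_itv.
Qed.

Lemma prob_tau_le x (u : R) : 1 <= u -> P [set w | tau x w <= u] = (1 - u^-1)%:E.
Proof.
move=> u1; rewrite EFinB -(tail x) // -probability_setC; last first.
  rewrite (_ : [set w | _] = ~` [set w | tau x w <= u]).
    by apply: measurableC; exact: measurable_tau_le.
  by apply/seteqP; split => t /=; rewrite ltNge => /negP.
congr (P _); apply/seteqP; split => t /=; first by rewrite leNgt => /negP.
by move=> /negP; rewrite -leNgt.
Qed.

Lemma tail_pair_indep x y (u v : R) : x != y ->
  P ([set w | u < tau x w] `&` [set w | v < tau y w]) =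
  (P [set w | (u < tau x w)%R] * P [set w | (v < tau y w)%R])%E.
Proof.
move=> xy.
pose B z : set R := if z == x then `]u, +oo[%classic else `]v, +oo[%classic.
have mB z : measurable (B z) by rewrite /B; case: eqP => _; exact: measurable_itv.
have xyu : uniq [:: x; y] by rewrite /= inE xy.
have := indep [:: x; y] B xyu mB.
rewrite !big_cons big_nil mule1 /B eqxx eq_sym (negbTE xy).
have -> z (c : R) : tau z @^-1` `]c, +oo[%classic = [set w | c < tau z w].
  by apply/seteqP; split => t /=; rewrite in_itv/= andbT.
have -> z (c : R) : tau z @^-1` `]c, +oo[%classic = [set w | c < tau z w].
  by apply/seteqP; split => t /=; rewrite in_itv/= andbT.
move=> <-; congr (P _); apply/seteqP; split => t /=.
  move=> [h1 h2] z /=; rewrite !inE => /orP[/eqP ->|/eqP ->].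
    by rewrite eqxx/= in_itv/= h1.
  by rewrite eq_sym (negbTE xy)/= in_itv/= h2.
move=> h; split.
  by have := h x; rewrite /= !inE !eqxx/= in_itv/= andbT; apply.
by have := h y; rewrite /= !inE eqxx orbT eq_sym (negbTE xy)/= in_itv/= andbT; apply.
Qed.

Lemma prob_all_le (u : nat -> R) N M : (forall x, (N <= x)%N -> 1 <= u x) ->
  (P (\bigcap_(x in [set x | N <= x < M]%N) [set w | (tau x%:Z w <= u x)%R]) =
   (\prod_(N <= x < M) (1 - (u x)^-1))%:E)%E.
Proof.
move=> u1.
pose J := [seq x%:Z | x <- index_iota N M].
pose B (z : int) : set R := `]-oo, u `|z|%N]%classic.
have mB z : measurable (B z) by exact: measurable_itv.
have uJ : uniq J by rewrite map_inj_uniq ?iota_uniq// => a b [].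
have := indep J B uJ mB; rewrite big_map.
have pre x : tau x%:Z @^-1` B x%:Z = [set w | tau x%:Z w <= u x].
  by apply/seteqP; split => t; rewrite /B/= in_itv/=.
under eq_bigr do rewrite pre.
rewrite big_nat (eq_bigr (fun x => (1 - (u x)^-1)%:E)); last first.
  by move=> x /andP[Nx _]; rewrite prob_tau_le ?u1.
rewrite -big_nat prodEFin => <-; congr (P _); apply/seteqP; split => t h.
  move=> z /= /mapP[x]; rewrite mem_index_iota => xM ->.
  by have := h x xM; rewrite -pre.
move=> x /= xM; rewrite -/([set w | tau x%:Z w <= u x] t) -pre.
by apply: h; rewrite /=; apply/mapP; exists x => //; rewrite mem_index_iota.
Qed.

Definition big_level (a : R) (x : nat) : R := a * (x%:R * ln x%:R * ln (ln x%:R)).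

(** By independence, the probability that all sites in [[N, M)] stay below their level is a product
    of factors [1 - 1 / u]. Each is at most [expR (- 1 / u)], so [ln3_step] bounds the product by
    [expR ((ln3 N - ln3 M) / a)], which tends to 0 as [M] grows. *)
Lemma negligible_small_tail (a : R) N : 1 <= a -> (16 <= N)%N ->
  P.-negligible [set w | forall x : nat, (N <= x)%N -> tau x%:Z w <= big_level a x].
Proof.
move=> a1 N16.
have ge16 x : (N <= x)%N -> (16 : R) <= x%:R by move=> Nx; rewrite (ler_nat _ 16) (leq_trans N16).
have u1 x : (N <= x)%N -> 1 <= big_level a x.
  move=> /ge16 x16; have l1 := ln16_ge2 _ x16; have l2 := lnln16_ge _ x16.
  rewrite /big_level; move: l1 l2; move: (ln x%:R) (ln (ln x%:R)) => l1 l2 h1 h2.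
  have b1 : 2 <= x%:R * l1 by move: h1 x16; nra.
  have b2 : 1 <= x%:R * l1 * l2 by move: b1 h2; nra.
  by move: a1 b2; nra.
pose E M := \bigcap_(x in [set x | N <= x < M]%N) [set w | tau x%:Z w <= big_level a x].
have mE M : measurable (E M) by apply: bigcap_measurableType => x _; exact: measurable_tau_le.
have PE M : (N <= M)%N -> (P (E M) <= (expR ((ln3 N%:R - ln3 M%:R) / a))%:E)%E.
  move=> NM; rewrite prob_all_le// lee_fin.
  have e : (ln3 N%:R - ln3 M%:R) / a = \sum_(N <= x < M) (ln3 x%:R - ln3 x.+1%:R) / a.
    rewrite -mulr_suml; congr (_ / _).
    rewrite -[LHS]opprB -(telescope_sumr (fun x : nat => ln3 x%:R))// -sumrN.
    by apply: eq_bigr => i _; rewrite opprB.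
  rewrite e expR_sum big_nat [leRHS]big_nat; apply: ler_prod => x /andP[Nx _].
  rewrite subr_ge0 invf_le1 ?u1// ?(lt_le_trans _ (u1 _ Nx))//=.
  apply: (le_trans (expR_ge1Dx _)); rewrite ler_expR.
  rewrite /big_level invfM -mulNr mulrC -natr1.
  have := ln3_step _ (ge16 _ Nx).
  have a0 : 0 < a^-1 by rewrite invr_gt0; lra.
  by move=> h; rewrite mulrC mulNr -mulrN mulrC ler_pM2r//; lra.
exists (\bigcap_M E M); split.
- exact: bigcap_measurableType.
- have mB : measurable (\bigcap_M E M) by exact: bigcap_measurableType.
  apply/eqP; rewrite eq_le measure_ge0 andbT.
  apply/lee_addgt0Pr => e e0; rewrite add0e.
  have [M NM hM] := ln3_unbounded (ln3 N%:R - a * ln e) N.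
  apply: (@le_trans _ _ (P (E M))).
    by apply: le_measure; rewrite ?inE//; exact: bigcap_inf.
  apply: (le_trans (PE M NM)); rewrite lee_fin -[leRHS]lnK ?posrE// ler_expR.
  by rewrite ler_pdivrMr; lra.
- by move=> w h M _ x /= /andP[Nx _]; exact: h.
Qed.

(** The constant ranges over positive integers, so that only countably many null sets are
    discarded. *)
Lemma ae_big_site : {ae P, forall w, forall a N : nat,
  exists2 x : nat, (N <= x)%N & big_level a.+1%:R x < tau x%:Z w}.
Proof.
apply/ae_foralln => a; apply/ae_foralln => N.
have a1 : 1 <= a.+1%:R :> R by rewrite ler1n.
apply: negligibleS (negligible_small_tail a.+1%:R (maxn N 16) a1 (leq_maxr _ _)).
move=> w h x Nx; rewrite leNgt; apply/negP => hx; apply: h.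
by exists x => //; apply: leq_trans Nx; exact: leq_maxl.
Qed.

Lemma ae_tau_ge1 : {ae P, forall w, forall x, 1 <= tau x w}.
Proof.
have h x : P.-negligible (~` [set w | 1 <= tau x w]).
  exists [set w | tau x w <= 1]; split; first exact: measurable_tau_le.
    by rewrite prob_tau_le// invr1 subrr.
  by move=> w /= /negP; rewrite -ltNge => /ltW.
have h1 : {ae P, forall w, forall n : nat, 1 <= tau n%:Z w}.
  by apply/ae_foralln => n; exact: h.
have h2 : {ae P, forall w, forall n : nat, 1 <= tau (Negz n) w}.
  by apply/ae_foralln => n; exact: h.
by apply: filterS2 h1 h2 => w w1 w2 [].
Qed.

(** All that the asymptotics require of the environment; what follows from it is deterministic. *)
Record good_env (t : int -> R) : Prop := GoodEnv {
  env_ge1 : forall x, 1 <= t x;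
  env_lower : exists K, forall k, (K <= k)%N ->
    2 ^+ k * k%:R / 4 <= rsum t (2 ^ k) /\ 2 ^+ k * k%:R / 4 <= lsum t (2 ^ k);
  env_upper : exists K, forall k, (K <= k)%N ->
    rsum t (2 ^ k) <= 5 * 2 ^+ k * (k%:R * ln k%:R ^+ 2) /\
    lsum t (2 ^ k) <= 5 * 2 ^+ k * (k%:R * ln k%:R ^+ 2);
  env_upper_square : exists K, forall j, (K <= j)%N ->
    rsum t (2 ^ (j ^ 2)) <= 5 * 2 ^+ (j ^ 2) * (j ^ 2)%:R /\
    lsum t (2 ^ (j ^ 2)) <= 5 * 2 ^+ (j ^ 2) * (j ^ 2)%:R;
  env_big : forall a N : nat, exists2 x : nat, (N <= x)%N & big_level a.+1%:R x < t x%:Z }.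

Lemma exists_both (A B : nat -> Prop) :
  (exists K, forall k, (K <= k)%N -> A k) -> (exists K, forall k, (K <= k)%N -> B k) ->
  exists K, forall k, (K <= k)%N -> A k /\ B k.
Proof.
move=> [K1 h1] [K2 h2]; exists (maxn K1 K2) => k; rewrite geq_max => /andP[k1 k2].
by split; [exact: h1|exact: h2].
Qed.

Lemma ae_good_env : {ae P, forall w, good_env (fun x => tau x w)}.
Proof.
pose Xr (i : nat) := tau i.+1%:Z; pose Xl (i : nat) := tau (- i.+1%:Z).
have mr i : measurable_fun setT (Xr i) by exact: mtau.
have ml i : measurable_fun setT (Xl i) by exact: mtau.
have tr i u : 1 <= u -> P [set w | u < Xr i w] = (u^-1)%:E by exact: tail.
have tl i u : 1 <= u -> P [set w | u < Xl i w] = (u^-1)%:E by exact: tail.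
have ir i j (u v : R) : i != j -> P ([set w | u < Xr i w] `&` [set w | v < Xr j w]) =
    (P [set w | (u < Xr i w)%R] * P [set w | (v < Xr j w)%R])%E.
  by move=> ij; apply: tail_pair_indep; lia.
have il i j (u v : R) : i != j -> P ([set w | u < Xl i w] `&` [set w | v < Xl j w]) =
    (P [set w | (u < Xl i w)%R] * P [set w | (v < Xl j w)%R])%E.
  by move=> ij; apply: tail_pair_indep; lia.
have L1 := ae_sum_lower P Xr mr ir tr; have L2 := ae_sum_lower P Xl ml il tl.
have U1 := ae_sum_upper_log P Xr mr ir tr; have U2 := ae_sum_upper_log P Xl ml il tl.
have S1 := ae_sum_upper_square P Xr mr ir tr; have S2 := ae_sum_upper_square P Xl ml il tl.
have B := ae_big_site; have G := ae_tau_ge1.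
apply: filterS2 (filterI (filterI L1 L2) (filterI U1 U2)) (filterI (filterI S1 S2) (filterI B G)).
move=> w [[hL1 hL2] [hU1 hU2]] [[hS1 hS2] [hB hG]].
have g0 x : 0 <= tau x w by exact: le_trans (hG x).
split => //.
- by apply: exists_both; [apply: hL1 => i; exact: g0|apply: hL2 => i; exact: g0].
- exact: exists_both hU1 hU2.
- exact: exists_both hS1 hS2.
Qed.

End Environment.

(** * Asymptotics of the heat kernel *)

Section LimitsAtInfinity.
Context {R : realType}.
Implicit Types (f : R -> R) (c C S : R).

Lemma limsup_pinfty_le f S C : (forall s, S <= s -> f s <= C) -> (limsup_pinfty f <= C%:E)%E.
Proof.
move=> h; apply: (@le_trans _ _ (ereal_sup [set (f t)%:E | t in [set t | S <= t]])).
  by apply: ereal_inf_lbound; exists S.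
by apply: ge_ereal_sup => _ [s Ss <-]; rewrite lee_fin h.
Qed.

Lemma limsup_pinfty_ge f c : (forall S, exists2 s, S <= s & c <= f s) -> (c%:E <= limsup_pinfty f)%E.
Proof.
move=> h; apply: le_ereal_inf_tmp => _ [S _ <-]; have [s Ss cs] := h S.
apply: (@le_trans _ _ (f s)%:E); first by rewrite lee_fin.
by apply: ereal_sup_ubound; exists s.
Qed.

Lemma liminf_pinfty_eq0 f : (forall s, 0 <= s -> 0 <= f s) ->
  (forall e S, 0 < e -> exists2 s, S <= s & f s <= e) -> liminf_pinfty f = 0%E.
Proof.
move=> f0 h; apply/eqP; rewrite eq_le; apply/andP; split.
  apply: ge_ereal_sup => _ [S _ <-]; apply/lee_addgt0Pr => e e0; rewrite add0e.
  have [s Ss fs] := h e S e0.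
  apply: (@le_trans _ _ (f s)%:E); last by rewrite lee_fin.
  by apply: ereal_inf_lbound; exists s.
apply: (@le_trans _ _ (ereal_inf [set (f t)%:E | t in [set t | 0 <= t]])).
  by apply: le_ereal_inf_tmp => _ [s s0 <-]; rewrite lee_fin f0.
by apply: ereal_sup_ubound; exists 0.
Qed.

Lemma liminf_pinfty_eqy f : (forall C, exists S, forall s, S <= s -> C <= f s) ->
  liminf_pinfty f = +oo%E.
Proof.
move=> h; apply/eqyP => C C0; have [S hS] := h C.
apply: (@le_trans _ _ (ereal_inf [set (f t)%:E | t in [set t | S <= t]])).
  by apply: le_ereal_inf_tmp => _ [s Ss <-]; rewrite lee_fin hS.
by apply: ereal_sup_ubound; exists S.
Qed.

(** Turns division by [phi1 s] into multiplication by a square root, the form used in all the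
    estimates below. *)
Lemma phi1V (s : R) : 1 < s -> (phi1 s)^-1 = Num.sqrt (s * ln s).
Proof.
move=> s1; have s0 : 0 < s by lra.
rewrite /phi1 !powRN -invfM invrK !powR12_sqrt ?(ltW s0) ?ln_ge0 ?ltW//.
by rewrite sqrtrM// ltW.
Qed.

Lemma phi1_ge0 (s : R) : 0 <= phi1 s.
Proof. by rewrite mulr_ge0 ?powR_ge0. Qed.

(** Take the least index at which [f] exceeds [s]; its predecessor works, and [f K <= s] excludes
    [K] itself. *)
Lemma bracket (f : nat -> R) K (s : R) : f K <= s -> (exists n, s < f (K + n)%N) ->
  exists2 k, (K <= k)%N & f k <= s < f k.+1.
Proof.
move=> fK ex; case: (ex_minnP ex) => -[|n] sn nmin.
  by move: sn; rewrite addn0 ltNge fK.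
exists (K + n)%N; first exact: leq_addr.
rewrite -addnS sn andbT leNgt; apply/negP => /nmin; by rewrite ltnn.
Qed.

Lemma ln_nat_le (k : nat) : (0 < k)%N -> ln k%:R <= k%:R :> R.
Proof.
by move=> k0; have := @ln_le_sub1 R k%:R; rewrite ltr0n => /(_ k0); lra.
Qed.

Lemma ln2_le1 : ln 2 <= 1 :> R.
Proof. by have := @ln_le_sub1 R 2; rewrite (_ : 2 - 1 = 1); [apply|ring]. Qed.

Lemma pow42 (k : nat) : 4 ^+ k = (2 ^+ k) ^+ 2 :> R.
Proof. by rewrite -exprM mulnC exprM; congr (_ ^+ _); rewrite expr2; ring. Qed.

Lemma ln_pow4 (k : nat) : ln (4 ^+ k) = 2 * k%:R * ln 2 :> R.
Proof.
by rewrite pow42 -exprM lnXn// -[LHS]mulr_natl natrM; ring.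
Qed.

Lemma sqrtr_sqr_pos (x : R) : 0 <= x -> Num.sqrt (x ^+ 2) = x.
Proof. by move=> x0; rewrite sqrtr_sqr ger0_norm. Qed.

End LimitsAtInfinity.

(** * Bounds on the time scales [4 ^ k * k], matched with radius [2 ^ k] *)

Section GoodEnvironment.
Context {R : realType}.
Variable t : int -> R.
Hypothesis tG : good_env t.

Let t1 : forall x, 1 <= t x. Proof. by case: tG. Qed.
Let t0 x : 0 < t x. Proof. exact: lt_le_trans (t1 x). Qed.
Notation hk := (hk t).

(** For [s] between consecutive values of [4 ^ k * k], radius [2 ^ k] balances the two terms of
    [hk_upper]: both are of order [1 / (2 ^ k * k)], while the square root is of order
    [2 ^ k * k]. *)
Lemma log_volume_bound : exists C S : R,
  forall s, S <= s -> hk s * Num.sqrt (s * ln s) <= C.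
Proof.
have [K hK] := env_lower t tG.
pose f k : R := 4 ^+ k * k%:R.
(* The constant is [6 * 7], from [up] and [sq] below. *)
exists 42, (f K.+2) => s fs.
have [] := bracket f K.+2 s fs.
  exists (Num.truncn s).+1; apply: (@lt_le_trans _ _ (Num.truncn s).+1%:R).
    exact/real_truncnS_gt/num_real.
  rewrite /f; apply: (@le_trans _ _ (K.+2 + (Num.truncn s).+1)%:R).
    by rewrite ler_nat leq_addl.
  by rewrite ler_peMl// exprn_ege1// ler1n.
move=> k Kk /andP[lo hi].
have kK : (K <= k)%N by lia.
have k0 : (0 < k)%N by lia.
have kR : 1 <= k%:R :> R by rewrite ler1n.
have p1 : 1 <= 2 ^+ k :> R by rewrite exprn_ege1// ler1n.
have [rl ll] := hK k kK.
have p4 : 0 < 4 ^+ k :> R by rewrite exprn_gt0.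
have s0 : 0 < s by apply: lt_le_trans lo; rewrite mulr_gt0// ltr0n.
have V : 2 ^+ k * k%:R / 2 <= wsum (2 ^ k)%N t.
  by rewrite wsum_tauE; have := t0 0; move: rl ll; lra.
have pk : 0 < 2 ^+ k * k%:R :> R by rewrite mulr_gt0; lra.
have up : hk s <= 6 / (2 ^+ k * k%:R).
  apply: (le_trans (hk_upper t t1 (2 ^ k)%N s s0)).
  have b1 : 2 / wsum (2 ^ k)%N t <= 4 / (2 ^+ k * k%:R).
    rewrite (_ : 4 / _ = 2 / (2 ^+ k * k%:R / 2)); last first.
      by field; apply/andP; split; apply/eqP; lra.
    rewrite ler_pM2l// lef_pV2 ?posrE//; first by apply: lt_le_trans V; lra.
    by lra.
  have b2 : 2 * (2 ^ k)%:R / s <= 2 / (2 ^+ k * k%:R).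
    rewrite natrX ler_pdivrMr// (_ : 2 / _ * s = 2 * 2 ^+ k * (s / (4 ^+ k * k%:R))); last first.
      by rewrite pow42; field; apply/andP; split; apply/eqP; lra.
    rewrite -[leLHS]mulr1 ler_pM2l; last by lra.
    by rewrite ler_pdivlMr ?mul1r// mulr_gt0//; lra.
  by apply: (le_trans (lerD b1 b2)); rewrite -mulrDl (_ : 4 + 2 = 6)//; ring.
have sle : s <= 8 * (4 ^+ k * k%:R).
  apply: (le_trans (ltW hi)); rewrite /f exprS -(natr1 k).
  rewrite -subr_ge0 (_ : _ - _ = 4 * (4 ^+ k * (k%:R - 1))); last by ring.
  by rewrite mulr_ge0// mulr_ge0 ?(ltW p4)//; lra.
have s1 : 1 <= s.
  apply: le_trans lo; apply: (@le_trans _ _ k%:R); first by rewrite ler1n; lia.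
  by rewrite /f ler_peMl// exprn_ege1// ler1n.
have lns : ln s <= 6 * k%:R.
  apply: (@le_trans _ _ (ln (8 * (4 ^+ k * k%:R)))).
    by rewrite ler_ln ?posrE// mulr_gt0// mulr_gt0//; lra.
  rewrite lnM ?posrE ?mulr_gt0//; [|lra..]; rewrite lnM ?posrE//; last by lra.
  rewrite ln_pow4 (_ : 8 = 2 ^+ 3 :> R) ?lnXn//; last by ring.
  rewrite -[ln 2 *+ 3]mulr_natl; have := @ln2_le1 R; have := @ln_nat_le R k k0.
  have : 2 * k%:R * ln 2 <= 2 * k%:R * 1 :> R by rewrite ler_pM2l ?ln2_le1//; lra.
  by lra.
have sq : Num.sqrt (s * ln s) <= 7 * (2 ^+ k * k%:R).
  rewrite -[leRHS]sqrtr_sqr_pos; last by lra.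
  rewrite ler_wsqrtr//; apply: (@le_trans _ _ (8 * (4 ^+ k * k%:R) * (6 * k%:R))).
    by rewrite ler_pM ?ln_ge0//; lra.
  rewrite pow42 -subr_ge0 (_ : _ - _ = (2 ^+ k * k%:R) ^+ 2); last by ring.
  exact: sqr_ge0.
apply: (@le_trans _ _ (6 / (2 ^+ k * k%:R) * (7 * (2 ^+ k * k%:R)))).
  by rewrite ler_pM ?sqrtr_ge0//; apply: hk_ge0 => //; lra.
by rewrite le_eqVlt; apply/orP; left; apply/eqP; field; apply/andP; split; apply/eqP; lra.
Qed.

Lemma dyadic_time_lower : exists K, forall k, (K <= k)%N ->
  (4 * wsum (2 ^ k.+1)%N t)^-1 <= hk (4 ^+ k * k%:R / 2) /\
  2 ^+ k * k%:R / 2 <= Num.sqrt ((4 ^+ k * k%:R / 2) * ln (4 ^+ k * k%:R / 2)) :> R /\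
  k%:R <= ln (4 ^+ k * k%:R / 2) :> R.
Proof.
have [K hK] := env_lower t tG.
exists (K + 2)%N => k Kk.
have [|rl ll] := hK k; first by lia.
have kR : 2 <= k%:R :> R by rewrite (ler_nat _ 2); lia.
have p1 : 1 <= 2 ^+ k :> R by rewrite exprn_ege1// ler1n.
have p4 : 0 < 4 ^+ k :> R by rewrite exprn_gt0.
have lnk : k%:R <= ln (4 ^+ k * k%:R / 2) :> R.
  rewrite -mulrA lnM ?posrE//; last by lra.
  rewrite ln_pow4; have h : 0 <= ln (k%:R / 2) :> R by apply: ln_ge0; lra.
  have : k%:R * 1 <= k%:R * (2 * ln 2) :> R.
    by rewrite ler_pM2l; have := @ln2_ge R; lra.
  by lra.
split; last split => //.
  (* This is time [2 s] with [s = m * (2 ^ k * k / 4)] and [m = 2 ^ k], where the last factor is the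
     lower bound on both one-sided volumes. *)
  rewrite (_ : 4 ^+ k * k%:R / 2 = 2 * ((2 ^ k)%:R * (2 ^+ k * k%:R / 4))); last first.
    by rewrite natrX pow42; field.
  have pk : 0 < (2 ^ k)%:R :> R by rewrite ltr0n expn_gt0.
  apply: (@hk_lower_dyadic _ t t1 _ (2 ^ k)%N).
  - by rewrite mulr_gt0// divr_gt0// mulr_gt0; lra.
  - by rewrite expnS.
  - by rewrite ler_pM2l.
  - by rewrite ler_pM2l.
rewrite -[leLHS]sqrtr_sqr_pos; last by rewrite divr_ge0// mulr_ge0; lra.
rewrite ler_wsqrtr//; apply: (@le_trans _ _ (4 ^+ k * k%:R / 2 * k%:R)).
  rewrite pow42 -subr_ge0 (_ : _ - _ = (2 ^+ k * k%:R / 2) ^+ 2); last by field.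
  exact: sqr_ge0.
by rewrite ler_pM2l// divr_gt0// mulr_gt0//; lra.
Qed.

End GoodEnvironment.

Section GoodEnvironmentLimits.
Context {R : realType}.
Variable t : int -> R.
Hypothesis tG : good_env t.

Let t1 : forall x, 1 <= t x. Proof. by case: tG. Qed.
Let t0 x : 0 < t x. Proof. exact: lt_le_trans (t1 x). Qed.
Notation hk := (hk t).

Lemma nat_above (x : R) : exists N : nat, x <= N%:R.
Proof. by exists (Num.truncn x).+1; exact/ltW/real_truncnS_gt/num_real. Qed.

Lemma dyadic_time_ge (k : nat) : k%:R <= 4 ^+ k * k%:R / 2 :> R.
Proof.
case: k => [|k]; first by rewrite mulr0 mul0r.
have : 1 * k.+1%:R <= 4 ^+ k * k.+1%:R :> R by rewrite ler_wpM2r// exprn_ege1// ler1n.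
have : 0 <= 4 ^+ k * k.+1%:R :> R by rewrite mulr_ge0// exprn_ge0.
by rewrite exprS; lra.
Qed.

Lemma hk_frequently_large S :
  exists2 s : R, S <= s & 352^-1 <= hk s * Num.sqrt (s * ln s).
Proof.
have [K1 hK1] := dyadic_time_lower t tG.
have [K2 hK2] := env_upper_square t tG.
have [N1 hN1] := nat_above S; have [N2 hN2] := nat_above (t 0).
(* The lower bound at scale [k] involves the volume at radius [2 ^ (k + 1)], so [k + 1] is taken to
   be a square. The final constant is [4 * 44 * 2 = 352]. *)
pose j := (K1 + K2 + N1 + N2 + 2)%N; pose k := (j ^ 2).-1.
have kj : (j <= k)%N by rewrite /k -mulnn; have : (2 <= j)%N by [lia|]; nia.
have jk : (j ^ 2)%N = k.+1 by rewrite /k; have : (2 <= j)%N by [lia|]; nia.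
have [K1k K2j N1k' N2k' k2] : [/\ (K1 <= k), (K2 <= j), (N1 <= k), (N2 <= k) & (2 <= k)]%N.
  by move: kj; rewrite /j; clearbody k; clear; split; lia.
have [h1 [h2 _]] := hK1 k K1k.
have [r1 l1] := hK2 j K2j.
rewrite jk in r1 l1.
have kR : 2 <= k%:R :> R by rewrite (ler_nat _ 2).
have N2k : t 0 <= k%:R by apply: (le_trans hN2); rewrite ler_nat.
have N1k : S <= k%:R by apply: (le_trans hN1); rewrite ler_nat.
exists (4 ^+ k * k%:R / 2); first exact: (le_trans N1k (dyadic_time_ge k)).
have p1 : 1 <= 2 ^+ k :> R by rewrite exprn_ege1// ler1n.
have pk : 0 < 2 ^+ k * k%:R :> R by rewrite mulr_gt0; lra.
have kpk : k%:R <= 2 ^+ k * k%:R :> R by rewrite ler_peMl//; lra.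
have ppk : 2 ^+ k * 2 <= 2 ^+ k * k%:R :> R by rewrite ler_pM2l//; lra.
have V : wsum (2 ^ k.+1)%N t <= 44 * (2 ^+ k * k%:R).
  rewrite wsum_tauE; move: r1 l1; rewrite exprS -(natr1 k) => r1 l1.
  by move: r1 l1; lra.
have low : (4 * (44 * (2 ^+ k * k%:R)))^-1 <= hk (4 ^+ k * k%:R / 2).
  apply: le_trans h1; rewrite lef_pV2 ?posrE ?mulr_gt0 ?wsum_tau_gt0//; lra.
apply: (@le_trans _ _ ((4 * (44 * (2 ^+ k * k%:R)))^-1 * (2 ^+ k * k%:R / 2))).
  rewrite le_eqVlt; apply/orP; left; apply/eqP; field; apply/andP; split; apply/eqP; lra.
by rewrite ler_pM// ?invr_ge0; lra.
Qed.

Lemma inv_volume_le (a b c : R) : 0 < a -> a <= c * b -> (4 * (c * b))^-1 <= (4 * a)^-1.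
Proof.
move=> a0 ab; have h : 0 < c * b by exact: lt_le_trans ab.
have h4 : 0 < 4 * (c * b) by exact: mulr_gt0.
have a4 : 0 < 4 * a by exact: mulr_gt0.
by rewrite lef_pV2// ler_pM2l.
Qed.

(** The volume costs [L ^ 2] and the iterated logarithm supplies [L ^ 3]; the surplus factor [L] is
    what diverges. *)
Lemma lower_product (c q L h l r : R) : 0 < c -> 0 < q -> 0 < L ->
  (4 * (c * (q * L ^+ 2)))^-1 <= h -> L ^+ 3 <= l -> q / 2 <= r ->
  L / (8 * c) <= h * l * r.
Proof.
move=> c0 q0 L0 hh hl hr.
rewrite (_ : L / (8 * c) = (4 * (c * (q * L ^+ 2)))^-1 * L ^+ 3 * (q / 2)); last first.
  by field; rewrite !gt_eqF.
have L3 : 0 <= L ^+ 3 by rewrite exprn_ge0// ltW.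
have i0 : 0 <= (4 * (c * (q * L ^+ 2)))^-1.
  by rewrite invr_ge0 mulr_ge0// mulr_ge0 ?(ltW c0)// mulr_ge0 ?(ltW q0)// sqr_ge0.
have q2 : 0 <= q / 2 by rewrite divr_ge0// ltW.
by apply: ler_pM => //; [rewrite mulr_ge0|exact: ler_pM].
Qed.

Lemma hk_eventually_large (C theta : R) : 3 < theta ->
  exists S, forall s, S <= s -> C <= hk s * (ln (ln s)) `^ theta * Num.sqrt (s * ln s).
Proof.
(* The value is [160 + 160 + 1]: two one-sided volumes and the site 0. It is hidden behind [c] and
   revealed only in the volume bound. *)
move=> th3; have [c c0 cE] : exists2 c : R, 0 < c & c = 321.
  by exists 321; first exact: ltr0Sn.
have [K1 hK1] := dyadic_time_lower t tG.
have [K2 hK2] := env_upper t tG.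
have [N1 hN1] := nat_above (expR (8 * c * C)); have [N2 hN2] := nat_above (t 0).
pose K := (K1 + K2 + N1 + N2 + 4)%N.
pose f k : R := 4 ^+ k * k%:R / 2.
exists (f K) => s fs.
have [] := bracket f K s fs.
  have [N hN] := nat_above s; exists N.+1.
  apply: (le_lt_trans hN); apply: lt_le_trans (dyadic_time_ge _).
  by rewrite ltr_nat addnS ltnS leq_addl.
move=> k Kk /andP[lo hi].
have [K1k K2k N1k N2k' k4] :
    [/\ (K1 <= k), (K2 <= k.+2), (N1 <= k), (N2 <= k) & (4 <= k)]%N.
  by move: Kk; rewrite /K; clear; split; lia.
have kR : 4 <= k%:R :> R by rewrite (ler_nat _ 4).
have N2k : t 0 <= k%:R by apply: (le_trans hN2); rewrite ler_nat.
have kk : (k.+2 <= k * k)%N by move: k4; clear; nia.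
have k2k : (k.+2 <= k * 2)%N by move: k4; clear; lia.
have lk1 : 1 <= ln k%:R :> R by apply: ln_ge1.
have lkC : 8 * c * C <= ln k%:R.
  rewrite -[leLHS]expRK ler_ln ?posrE ?expR_gt0//; last by exact: lt_le_trans kR.
  by apply: (le_trans hN1); rewrite ler_nat.
have p1 : 1 <= 2 ^+ k :> R by rewrite exprn_ege1// ler1n.
have pk : 0 < 2 ^+ k * k%:R :> R.
  by rewrite mulr_gt0//; exact: lt_le_trans kR.
have kpk : k%:R <= 2 ^+ k * k%:R :> R by rewrite ler_peMl.
have lk2 : ln k.+2%:R <= 2 * ln k%:R :> R.
  rewrite (_ : 2 * ln _ = ln (k%:R * k%:R)); last first.
    by rewrite lnM ?posrE ?(lt_le_trans _ kR)// -mulr2n mulr_natl.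
  rewrite ler_ln ?posrE ?ltr0n//; last by rewrite mulr_gt0// (lt_le_trans _ kR).
  by rewrite -natrM ler_nat.
have sq1 : 1 <= ln k%:R ^+ 2 :> R by rewrite exprn_ege1.
have pkl : 2 ^+ k * k%:R <= 2 ^+ k * k%:R * ln k%:R ^+ 2 :> R.
  by rewrite ler_peMr// ltW.
have V : wsum (2 ^ k.+2)%N t <= c * (2 ^+ k * k%:R * ln k%:R ^+ 2).
  have e2 : 5 * 2 ^+ k.+2 * (k.+2%:R * ln k.+2%:R ^+ 2) <=
      160 * (2 ^+ k * k%:R * ln k%:R ^+ 2) :> R.
    have q1 : k.+2%:R * ln k.+2%:R ^+ 2 <= (2 * k%:R) * (2 * ln k%:R) ^+ 2 :> R.
      apply: ler_pM => //; first by rewrite sqr_ge0.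
        by rewrite mulrC -(natrM _ _ 2) ler_nat.
      have h1 : 0 <= ln k.+2%:R :> R by rewrite ln_ge0// ler1n.
      by rewrite lerXn2r ?nnegrE// mulr_ge0// (le_trans _ lk1).
    apply: (@le_trans _ _ (5 * 2 ^+ k.+2 * ((2 * k%:R) * (2 * ln k%:R) ^+ 2))).
      by rewrite ler_wpM2l// mulr_ge0// exprn_ge0.
    by rewrite le_eqVlt; apply/orP; left; apply/eqP; rewrite !exprS; ring.
  have [r1 l1] := hK2 k.+2 K2k.
  rewrite wsum_tauE; apply: (@le_trans _ _ (2 ^+ k * k%:R * ln k%:R ^+ 2 +
     160 * (2 ^+ k * k%:R * ln k%:R ^+ 2) + 160 * (2 ^+ k * k%:R * ln k%:R ^+ 2))).
    by apply: lerD (le_trans l1 e2); apply: lerD (le_trans r1 e2);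
       exact: le_trans N2k (le_trans kpk pkl).
  by rewrite le_eqVlt; apply/orP; left; apply/eqP; rewrite cE; ring.
set L := ln k%:R in lk1 lkC lk2 sq1 pkl V *.
have pL : 0 < 2 ^+ k * k%:R * L ^+ 2 by apply: lt_le_trans pkl.
have f0 : 0 <= f k by rewrite /f divr_ge0// mulr_ge0// exprn_ge0.
have fk : k%:R <= f k by exact: dyadic_time_ge.
have fS0 : 0 <= f k.+1 by rewrite /f divr_ge0// mulr_ge0// exprn_ge0.
have kpos : 0 < k%:R :> R by exact: lt_le_trans kR.
have ppos : 0 < 2 ^+ k :> R by exact: lt_le_trans p1.
have Lpos : 0 < L by exact: lt_le_trans lk1.
have s0 : 0 < s by apply: lt_le_trans lo; exact: lt_le_trans fk.
have fpos : 0 < f k by exact: lt_le_trans fk.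
have kls : k%:R <= ln (f k) by have [_ [_ h3]] := hK1 k K1k.
have lns : ln (f k) <= ln s by rewrite ler_ln ?posrE.
(* Between the two scales, monotonicity compares [hk s] with its value at the later one, hence the
   radius [2 ^ (k + 2)]; the logarithms and the square root are bounded from the earlier one. *)
have low : (4 * (c * (2 ^+ k * k%:R * L ^+ 2)))^-1 <= hk s.
  apply: le_trans (hk_nonincreasing t t1 s (f k.+1) (ltW s0) (ltW hi)).
  have [h1 _] := hK1 k.+1 (leqW K1k).
  apply: le_trans h1; apply: inv_volume_le => //; exact: wsum_tau_gt0.
have Ls : L <= ln (ln s).
  have kls' := le_trans kls lns.
  by rewrite /L ler_ln ?posrE//; exact: lt_le_trans kls'.
have pow : L ^+ 3 <= ln (ln s) `^ theta.
  have lls1 := le_trans lk1 Ls.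
  apply: (@le_trans _ _ (ln (ln s) ^+ 3)).
    by rewrite lerXn2r ?nnegrE ?(ltW Lpos)// (le_trans (ltW Lpos)).
  by rewrite -powR_mulrn ?(le_trans ler01)// ler_powR// ltW.
have sq : 2 ^+ k * k%:R / 2 <= Num.sqrt (s * ln s).
  have [_ [h2 _]] := hK1 k K1k.
  apply: (le_trans h2); rewrite ler_wsqrtr// -/(f k) ler_pM//.
  exact: le_trans (ltW kpos) kls.
apply: le_trans (lower_product _ _ _ _ _ _ c0 pk Lpos low pow sq).
by rewrite ler_pdivlMr ?mulr_gt0// mulrC.
Qed.

Lemma hk_frequently_small (e S : R) : 0 < e -> exists s, [/\ S <= s, 1 < s &
  hk s * (ln (ln s)) `^ 2^-1 * Num.sqrt (s * ln s) <= e].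
Proof.
move=> e0.
(* The final bound is [28 / Num.sqrt a.+1], so [a] is taken large enough to make it at most [e]. *)
have [a ha] := nat_above ((28 / e) ^+ 2); have [N hN] := nat_above S.
have [x Nx big] := env_big t tG a (N + a + 16)%N.
have [x16' Nx' ax x0] : [/\ (16 <= x), (N <= x), (a < x) & (0 < x)]%N.
  by move: Nx; clear; split; lia.
have x16 : 16 <= x%:R :> R by rewrite (ler_nat _ 16).
have l1 := ln16_ge2 _ x16; have l2 := lnln16_ge _ x16.
have Sx : S <= x%:R by apply: (le_trans hN); rewrite ler_nat.
have Ax : a.+1%:R <= x%:R :> R by rewrite ler_nat.
have l1x : ln x%:R <= x%:R :> R by exact: ln_nat_le.
have l2x : ln (ln x%:R) <= ln x%:R :> R by have := @ln_le_sub1 R (ln x%:R); lra.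
have A1 : 1 <= a.+1%:R :> R by rewrite ler1n.
have Ae : 28 / e <= Num.sqrt a.+1%:R.
  rewrite -[leLHS]sqrtr_sqr_pos; last by rewrite divr_ge0// ltW.
  by rewrite ler_wsqrtr// (le_trans ha)// ler_nat.
have five : ln 5 <= 4 :> R by have := @ln_le_sub1 R 5; lra.
move: big; rewrite /big_level; set A : R := a.+1%:R in Ax A1 Ae *; set y : R := x%:R in x16 l1 l2 Sx Ax l1x l2x *.
set p := ln y in l1 l2 l1x l2x *; set q := ln p in l2 l2x *.
set u := y * p * q => big.
have yp : 2 <= y * p by nra.
have u1 : 1 <= u by rewrite /u; nra.
(* At this time both terms of [hk_upper] with radius [x] are at most [2 / (A * u)], because the
   single site [x] already has volume above [A * u]. *)
pose s := A * u * y.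
have Au : 1 <= A * u by nra.
have Aupos : 0 < A * u by lra.
have ys : y <= s by rewrite /s ler_peMl//; lra.
have s0 : 0 < s by lra.
(* Since [x] was chosen beyond [a], [A <= y]; a polynomial bound on [s] makes [ln s] comparable with
   [ln y]. *)
have s5 : s <= y ^+ 5.
  have h1 : y * p <= y * y by rewrite ler_pM2l//; lra.
  have h2 : u <= y * y * y by rewrite /u ler_pM//; nra.
  rewrite /s (_ : y ^+ 5 = y * (y * y * y) * y); last by ring.
  by rewrite ler_pM2r; [rewrite ler_pM|]; lra.
have lns : ln s <= 5 * p.
  rewrite /p mulr_natl -lnXn; last by lra.
  by rewrite ler_ln ?posrE ?exprn_gt0//; lra.
have plns : p <= ln s by rewrite /p ler_ln ?posrE//; lra.
have llns : ln (ln s) <= 9 * q.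
  apply: (@le_trans _ _ (ln (5 * p))); first by rewrite ler_ln ?posrE//; lra.
  by rewrite lnM ?posrE -/q//; lra.
have llns0 : 0 <= ln (ln s) by apply: ln_ge0; lra.
exists s; split; [lra|lra|].
have up : hk s <= 4 / (A * u).
  apply: (le_trans (hk_upper t t1 x s s0)).
  have b1 : 2 / wsum x t <= 2 / (A * u).
    rewrite ler_pM2l// lef_pV2 ?posrE ?wsum_tau_gt0//.
    apply: (le_trans (ltW big)); rewrite wsum_tauE.
    have : t x%:Z <= rsum t x.
      rewrite /rsum -(prednK x0) big_nat_recr//= ler_wpDl//.
      by apply: sumr_ge0 => i _; exact/ltW/t0.
    have : 0 <= lsum t x by apply: lsum_ge0; exact: t1.
    by have := t0 0; lra.
  have b2 : 2 * x%:R / s = 2 / (A * u).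
    by rewrite /s -/y; field; rewrite !gt_eqF//; lra.
  by rewrite b2; apply: (le_trans (lerD b1 (lexx _))); rewrite -mulrDl (_ : 2 + 2 = 4)//; ring.
(* The product under the root is at most [45 * u ^ 2 * A], rounded up to 49 to have an exact square:
   the exponent 1/2 supplies just the factor [q] that completes [u]. *)
have prod : ln (ln s) `^ 2^-1 * Num.sqrt (s * ln s) <= 7 * Num.sqrt A * u.
  rewrite powR12_sqrt// -sqrtrM//.
  rewrite (_ : 7 * Num.sqrt A * u = Num.sqrt ((7 * u) ^+ 2 * A)); last first.
    by rewrite sqrtrM ?sqr_ge0// sqrtr_sqr_pos; [ring|lra].
  rewrite ler_wsqrtr//; apply: (@le_trans _ _ ((9 * q) * (s * (5 * p)))).
    apply: ler_pM => //; first by rewrite mulr_ge0 ?ln_ge0; lra.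
    by rewrite ler_pM2l.
  rewrite (_ : _ * _ = 45 * (u ^+ 2 * A)); last by rewrite /s /u; ring.
  have : 0 <= u ^+ 2 * A by rewrite mulr_ge0 ?sqr_ge0//; lra.
  rewrite [X in _ -> _ <= X](_ : _ = 49 * (u ^+ 2 * A)); last by ring.
  by move=> uA; rewrite ler_wpM2r// ler_nat.
have A0 : 0 < Num.sqrt A by rewrite sqrtr_gt0; lra.
apply: (@le_trans _ _ (4 / (A * u) * (7 * Num.sqrt A * u))).
  rewrite -mulrA; apply: ler_pM => //; first by apply: hk_ge0 => //; lra.
  by rewrite mulr_ge0 ?powR_ge0 ?sqrtr_ge0.
have -> : 4 / (A * u) * (7 * Num.sqrt A * u) = 28 / Num.sqrt A.
  rewrite -{1}[A]sqr_sqrtr; last by lra.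
  by field; rewrite !gt_eqF//; lra.
by rewrite ler_pdivrMr// mulrC -ler_pdivrMr.
Qed.

End GoodEnvironmentLimits.

Theorem mainTheorem2 (R : realType) (d : measure_display) (T : measurableType d)
  (P : probability T R) (tau : int -> T -> R) :
  (forall x, measurable_fun setT (tau x)) ->
  mutually_independent P tau ->
  (forall (x : int) (u : R), 1 <= u -> P [set w | u < tau x w] = (u^-1)%:E) ->
  {ae P, forall w,
    let p := fun t => heat_kernel (fun x => tau x w) t 0 0 in
    let L := limsup_pinfty (fun t => p t / phi1 t) in
    (0 < L)%E /\ (L < +oo)%E /\
    liminf_pinfty (fun t => p t * (ln (ln t)) `^ (2^-1) / phi1 t) = 0%E /\
    (forall theta : R, 3 < theta ->
       liminf_pinfty (fun t => p t * (ln (ln t)) `^ theta / phi1 t) = +oo%E)}.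
Proof.
move=> mtau indep tail.
(* From here on the environment is fixed and good, and each of the four claims is a deterministic
   estimate; the maxima with 2 ensure that [phi1V] applies. *)
apply: filterS (ae_good_env P tau mtau indep tail) => w G.
have t1 := env_ge1 _ G.
cbv zeta; set t := fun x => tau x w in G t1 *.
have pE s : heat_kernel t s 0 0 = hk t s by apply: heat_kernelE.
split; [|split; [|split]].
- apply: (@lt_le_trans _ _ (352^-1)%:E); first by rewrite lte_fin invr_gt0; exact: ltr0Sn.
  apply: limsup_pinfty_ge => S.
  have [s Ss hs] := hk_frequently_large t G (Num.max S 2).
  exists s; first by apply: le_trans Ss; rewrite le_max lexx.
  rewrite pE phi1V//; apply: lt_le_trans Ss.
  by rewrite lt_max orbC ltr1n.
- have [C [S hS]] := log_volume_bound t G.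
  apply: (@le_lt_trans _ _ C%:E); last by rewrite ltry.
  apply: (@limsup_pinfty_le _ _ (Num.max S 2)) => s; rewrite ge_max => /andP[Ss s2].
  by rewrite pE phi1V; [exact: hS|lra].
- apply: liminf_pinfty_eq0 => [s s0|e S e0].
    by rewrite pE divr_ge0 ?phi1_ge0// mulr_ge0 ?powR_ge0// hk_ge0.
  have [s [Ss s1 hs]] := hk_frequently_small t G e S e0.
  by exists s => //; rewrite pE phi1V.
move=> theta th3; apply: liminf_pinfty_eqy => C.
have [S hS] := hk_eventually_large t G C theta th3.
exists (Num.max S 2) => s; rewrite ge_max => /andP[Ss s2].
by rewrite pE phi1V; [exact: hS|lra].
Qed.
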